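(* Let $a\in D(N^* )$ and let $a_\star^T:N\to N$ be the dual of substitution with $a$, defined by $\langle a\star b,\omega\rangle=\langle b,a_\star^T(\omega)\rangle$ for all $b\in N^*$, $\omega\in N$. Then $a_\star^T(\mathbb I)=\mathbb I$, and for every forest $\omega\in OF$ with $\omega\neq\mathbb I$, $$a_\star^T(\omega)=\sum_{(\omega)\in\Delta_c}\ \sum_{c\in LAC(\omega_{(2)})}a_\star^T(\omega_{(1)})\;B^+\!\left(a_\star^T\big(P^c(\omega_{(2)})\big)\right)\,a\big(R^c(\omega_{(2)})\big),$$ where $\Delta_c(\omega)=\sum\omega_{(1)}\otimes\omega_{(2)}$ is the deconcatenation coproduct, the product of $a_\star^T(\omega_{(1)})$ and $B^+(\cdots)$ is concatenation, and $a(R^c(\omega_{(2)}))=\langle a,R^c(\omega_{(2)})\rangle$ is a scalar.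
   Context: **Trees and forests.** $OT$ is the set of ordered (planar) rooted trees, drawn with the root at the bottom; $OF$ is the set of ordered forests, i.e. all finite words (including the empty word $\mathbb I$) in the alphabet $OT$. $\bullet$ is the one-vertex tree, $B^+:OF\to OT$ adds a common root to the trees of a word (so $B^+(\mathbb I)=\bullet$; extended linearly to $N$), $B^-$ is its inverse (removing the root), and $|\omega|$ is the number of vertices. $N=\mathrm k\langle OT\rangle$ ($\mathrm k$ a field of characteristic $0$) is the vector space with basis $OF$, with concatenation as product; $N^*=\mathrm k\langle\langle OT\rangle\rangle$ is the space of infinite linear combinations of forests. $\langle\cdot,\cdot\rangle:N^*\times N\to\mathrm k$ is the pairing for which $OF$ is orthonormal; $a(\omega)=\langle a,\omega\rangle$. **Grafting.** $\curvearrowright:N\otimes N\to N$ is the bilinear product determined, for $\tau\in OT$, $\omega,\omega_1,\omega_2\in OF$, by $\mathbb I\curvearrowright\omega=\omega$, $\tau\curvearrowright\mathbb I=0$, $\omega\curvearrowright\bullet=B^+(\omega)$, $\tau\curvearrowright(\omega_1\omega_2)=(\tau\curvearrowright\omega_1)\omega_2+\omega_1(\tau\curvearrowright\omega_2)$, $(\tau\omega)\curvearrowright\omega_1=\tau\curvearrowright(\omega\curvearrowright\omega_1)-(\tau\curvearrowright\omega)\curvearrowright\omega_1$. It extends to $N^*$ by the grading. **Lie series and substitution.** $D(N)$ is the set of Lie polynomials: the smallest subspace of $N$ containing $OT$ and closed under $[x,y]=xy-yx$. $D(N^* )$ is the set of Lie series: elements of $N^*$ all of whose homogeneous components (with respect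 to $|\cdot|$) are Lie polynomials. For $a\in D(N^* )$, $a\star:N^*\to N^*$ is the unique D-algebra homomorphism sending $\bullet$ to $a$, i.e. the linear map (compatible with infinite sums) determined by $a\star\mathbb I=\mathbb I$, $a\star(\omega_1\omega_2)=(a\star\omega_1)(a\star\omega_2)$, $a\star B^+(\omega)=(a\star\omega)\curvearrowright a$. **Deconcatenation.** $\Delta_c(\tau_1\cdots\tau_n)=\sum_{i=0}^n\tau_1\cdots\tau_i\otimes\tau_{i+1}\cdots\tau_n$ for $\tau_j\in OT$, where empty words are $\mathbb I$. **Shuffle product.** $\sqcup\!\sqcup$ is the bilinear product on $N$ with $\mathbb I\sqcup\!\sqcup\omega=\omega=\omega\sqcup\!\sqcup\mathbb I$ and $(\tau_1\omega_1)\sqcup\!\sqcup(\tau_2\omega_2)=\tau_1(\omega_1\sqcup\!\sqcup\tau_2\omega_2)+\tau_2(\tau_1\omega_1\sqcup\!\sqcup\omega_2)$ for $\tau_i\in OT$, $\omega_i\in OF$. **Left admissible cuts.** A (nonempty) elementary left cut of a tree $\tau$ removes, at one vertex $v$ of $\tau$, a nonempty set of edges going up from $v$ such that with each edge all edges from $v$ to the left of it are also removed (i.e. the $k\ge1$ leftmost outgoing edges of $v$). Its pruned part is the word of the cut-off trees, concatenated from left to right. The empty cut is also allowed (pruned part $\mathbb I$, remaining part $\tau$). A left admissible cut $c$ of $\tau$ is a (possibly empty) collection of nonempty elementary left cuts, at distinct vertices, such that every path from the root to a vertex of $\tau$ crosses at most one elementary cut. $P^c(\tau)\in N$ is the shuffle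 product of the pruned words of the elementary cuts in $c$ (each word keeping its internal order; $P^c(\tau)=\mathbb I$ for the empty cut), and $R^c(\tau)\in OT$ is the remaining tree containing the root. $LAC(\tau)$ is the set of all left admissible cuts of $\tau$ (it includes the empty cut, but not a ''full'' cut below the root). For a forest $\omega$, $LAC(\omega)$ consists of the left admissible cuts of $B^+(\omega)$ that cut none of the edges growing out of the added root; $P^c(\omega)$ is the corresponding pruned part and $R^c(\omega)=B^-(R^c(B^+(\omega)))$. *)

(* Defs.v *)
From HB Require Import structures.
From mathcomp Require Import all_boot all_order all_algebra.
From mathcomp Require Import finmap zify.
From mathcomp Require Export monalg.

Set Implicit Arguments.
Unset Strict Implicit.
Unset Printing Implicit Defensive.

Import GRing.Theory.
Local Open Scope ring_scope.

(* [Node s] is B^+ of the word s; the leaf is [Node [::]]. *)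
Inductive otree : Type := Node of seq otree.

Definition children (t : otree) : seq otree := let: Node s := t in s.

Fixpoint otree_ind' (P : otree -> Prop) (Q : seq otree -> Prop)
    (PN : forall s, Q s -> P (Node s)) (Q0 : Q [::])
    (QS : forall t s, P t -> Q s -> Q (t :: s)) (t : otree) : P t :=
  let: Node s := t in
  PN s ((fix loop s : Q s :=
    if s is u :: s' then QS u s' (otree_ind' PN Q0 QS u) (loop s') else Q0) s).

Lemma otree_forest_ind (P : otree -> Prop) (Q : seq otree -> Prop) :
  (forall s, Q s -> P (Node s)) -> Q [::] ->
  (forall t s, P t -> Q s -> Q (t :: s)) ->
  (forall t, P t) /\ (forall s, Q s).
Proof.
move=> PN Q0 QS; have HP t : P t by exact: (otree_ind' PN Q0 QS t).
by split=> //; elim=> [|t s IH] //; apply: QS.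
Qed.

Fixpoint otree_enc (t : otree) : GenTree.tree unit :=
  let: Node s := t in GenTree.Node 0 (map otree_enc s).
Fixpoint otree_dec (g : GenTree.tree unit) : otree :=
  if g is GenTree.Node _ s then Node (map otree_dec s) else Node [::].

Lemma otree_encK : cancel otree_enc otree_dec.
Proof.
apply: (otree_ind' (Q := fun s => map otree_dec (map otree_enc s) = s)) => //.
- by move=> s /= ->.
- by move=> t s /= -> ->.
Qed.

HB.instance Definition _ := Countable.copy otree (can_type otree_encK).

(* Forests are the words of the free monoid; [mone] is the empty word. *)
Notation oforest := {fmonom otree}.

Definition Bplus (w : oforest) : otree := Node w.
Definition Bminus (t : otree) : oforest := FMonom (children t).

Fixpoint tvert (t : otree) : nat := let: Node s := t in (sumn (map tvert s)).+1.
Definition vert (w : oforest) : nat := sumn (map tvert w).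

(* All words with n vertices; the first argument is a recursion bound >= n. *)
Fixpoint words_rec (m n : nat) : seq (seq otree) :=
  match n, m with
  | 0, _ => [:: [::]]
  | n'.+1, m'.+1 =>
      flatten [seq [seq Node s :: r | s <- words_rec m' i,
                                      r <- words_rec m' (n' - i)]
              | i <- iota 0 n'.+1]
  | _, _ => [::]
  end.

Lemma mem_words_rec m n s : (n <= m)%N ->
  (s \in words_rec m n) = (sumn (map tvert s) == n).
Proof.
elim: m n s => [|m IH] [|n] s // le_nm.
- by case: s => [|[s] r].
- by case: s => [|[s] r].
have -> : words_rec m.+1 n.+1 = flatten [seq [seq Node s :: r
   | s <- words_rec m i, r <- words_rec m (n - i)] | i <- iota 0 n.+1] by [].
apply/flatten_mapP/eqP => [[i]|].
  rewrite mem_iota add0n ltnS /= => le_in /allpairsP[[u v] /= [Hu Hv ->]].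
  rewrite IH ?(leq_trans le_in) // in Hu.
  rewrite IH ?(leq_trans (leq_subr _ _)) // in Hv.
  by rewrite /= (eqP Hu) (eqP Hv) addSn subnKC.
case: s => [|[s] r] //=; rewrite addSn => -[En].
exists (sumn (map tvert s)); first by rewrite (mem_iota 0 n.+1) add0n ltnS -En leq_addr.
apply/allpairsP; exists (s, r); split=> //=.
  by rewrite IH // (leq_trans _ (le_nm : n <= m)%N) // -En leq_addr.
by rewrite IH ?(leq_trans (leq_subr _ _)) // -En addKn.
Qed.

HB.lock Definition forests (n : nat) : {fset oforest} :=
  seq_fset tt (map (@FMonom otree) (words_rec n n)).

Lemma mem_forests n w : (w \in forests n) = (vert w == n).
Proof.
rewrite forests.unlock seq_fsetE; case: w => s; rewrite mem_map; last by move=> ? ? [].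
by rewrite mem_words_rec.
Qed.

Notation Npoly k := {malg k[oforest]}.
Notation Nseries k := (oforest -> k).

HB.lock Definition linext (k : fieldType) (V : lmodType k) (f : oforest -> V)
    (x : Npoly k) : V :=
  \sum_(w <- msupp x) x@_w *: f w.

HB.lock Definition word (k : fieldType) (s : seq otree) : Npoly k :=
  << FMonom s >>.

HB.lock Definition hcomp (k : fieldType) (n : nat) (a : Nseries k) : Npoly k :=
  \sum_(w <- forests n) << a w *g w >>.

Section Algebra.
Context (k : fieldType).
Local Notation N := (Npoly k).
Local Notation Ns := (Nseries k).
Local Notation word := (word k).
Implicit Types (x y z : N) (w v : oforest) (s : seq otree) (t u : otree).

Definition pairing (b : Ns) (x : N) : k := \sum_(w <- msupp x) x@_w * b w.

Lemma linextEw (V : lmodType k) (f : oforest -> V) (d : {fset oforest}) x :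
  (msupp x `<=` d)%fset -> linext f x = \sum_(w <- d) x@_w *: f w.
Proof.
move=> le_d; rewrite linext.unlock; apply/big_fset_incl => // w _ Hw.
by rewrite mcoeff_outdom // scale0r.
Qed.

Lemma linext_is_linear (V : lmodType k) (f : oforest -> V) : linear (linext f).
Proof.
move=> c x y; pose d := (msupp x `|` msupp y)%fset.
rewrite (@linextEw _ _ d); last first.
  apply: (fsubset_trans (msuppD_le _ _)).
  by apply: fsetUSS; [exact: msuppZ_le|exact: fsubset_refl].
rewrite (@linextEw _ _ d x) ?fsubsetUl // (@linextEw _ _ d y) ?fsubsetUr //.
rewrite scaler_sumr -big_split /=; apply: eq_bigr => w _.
by rewrite mcoeffD mcoeffZ scalerDl scalerA.
Qed.

HB.instance Definition _ (V : lmodType k) (f : oforest -> V) :=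
  GRing.isLinear.Build k N V _ (linext f) (linext_is_linear f).

Lemma linextU (V : lmodType k) (f : oforest -> V) w : linext f << w >> = f w.
Proof. by rewrite linext.unlock msuppU1 big_seq_fset1 mcoeffUU scale1r. Qed.

Definition BplusN : N -> N := linext (fun w => word [:: Bplus w]).

Inductive lie_poly : N -> Prop :=
| lie_poly_tree t : lie_poly (word [:: t])
| lie_poly0 : lie_poly 0
| lie_polyD x y : lie_poly x -> lie_poly y -> lie_poly (x + y)
| lie_polyZ c x : lie_poly x -> lie_poly (c *: x)
| lie_poly_bracket x y :
    lie_poly x -> lie_poly y -> lie_poly (x * y - y * x).

Definition lie_series (a : Ns) : Prop := forall n, lie_poly (hcomp n a).

Definition derivation (D : otree -> N) : seq otree -> N :=
  fix L (s : seq otree) : N :=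
    if s is v :: s' then D v * word s' + word [:: v] * L s' else 0.

(* t ~> B^+(s) = t ~> (s ~> bullet) = (t s) ~> bullet + (t ~> s) ~> bullet
               = B^+(t s) + B^+(t ~> s). *)
Fixpoint graft_tree (t u : otree) : N :=
  let: Node s := u in
  word [:: Node (t :: s)] + BplusN (derivation (graft_tree t) s).

Definition graft_word (t : otree) (s : seq otree) : N :=
  derivation (graft_tree t) s.

(* t ~> s' has the same word length as s', so n := size s is enough fuel. *)
Fixpoint graft_rec (n : nat) (s : seq otree) (y : N) : N :=
  match n, s with
  | m.+1, t :: s' =>
      linext (graft_word t) (graft_rec m s' y)
      - linext (fun w => graft_rec m w y) (graft_word t s')
  | _, _ => y
  end.

End Algebra.

HB.lock Definition graft (k : fieldType) (x y : Npoly k) : Npoly k :=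
  linext (fun w => graft_rec (size w) w y) x.

Section Series.
Context (k : fieldType).
Local Notation N := (Npoly k).
Local Notation Ns := (Nseries k).
Local Notation word := (word k).

(* In degree n, the sum over i + j = n of op a_i b_j. *)
Definition gext2 (op : N -> N -> N) (a b : Ns) : Ns :=
  fun w => (\sum_(i < (vert w).+1) op (hcomp i a) (hcomp (vert w - i) b))@_w.

Definition sone : Ns := fun w => (w == mone)%:R.
Definition smul : Ns -> Ns -> Ns := gext2 *%R.
Definition sgraft : Ns -> Ns -> Ns := gext2 (@graft k).

Fixpoint subst_tree (a : Ns) (t : otree) : Ns :=
  let: Node s := t in
  sgraft (foldr smul sone (map (subst_tree a) s)) a.

Definition subst_word (a : Ns) (s : seq otree) : Ns :=
  foldr smul sone (map (subst_tree a) s).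

(* The sum over all forests v of b(v) (a * v)(w): when a has no constant term,
   a * v has no component below degree |v|. *)
Definition subst (a b : Ns) : Ns := fun w =>
  \sum_(i < (vert w).+1) \sum_(v <- forests i) b v * subst_word a v w.

Definition subst_dual (a : Ns) (aT : N -> N) : Prop :=
  forall (b : Ns) (x : N), pairing (subst a b) x = pairing b (aT x).

Fixpoint shuffle_word (s : seq otree) : seq otree -> N :=
  fix shuffle_s (r : seq otree) : N :=
  match s, r with
  | [::], _ => word r
  | _, [::] => word s
  | t :: s', u :: r' =>
      word [:: t] * shuffle_word s' r + word [:: u] * shuffle_s r'
  end.

Definition shuffle (x y : N) : N :=
  linext (fun w => linext (fun v => shuffle_word w v) y) x.

Definition deconc (w : oforest) : seq (oforest * oforest) :=
  [seq (FMonom (take i w), FMonom (drop i w)) | i <- iota 0 (size w).+1].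

End Series.

(* A tree in which every vertex carries the number of its leftmost outgoing
   edges that are removed; 0 means that there is no elementary cut there. *)
Inductive lcut : Type := LCut of nat & seq lcut.

Definition root_cut (c : lcut) : nat := let: LCut n _ := c in n.

Fixpoint cut_tree (c : lcut) : otree :=
  let: LCut _ cs := c in Node (map cut_tree cs).

Fixpoint cuts (t : otree) : seq lcut :=
  let: Node s := t in
  [seq LCut n cs
  | n <- iota 0 (size s).+1,
    cs <- foldr (fun l ls => [seq c :: cs | c <- l, cs <- ls])
                [:: [::]] (map cuts s)].

(* For every vertex, the number of elementary cuts crossed by the path leading
   to it from the root. *)
Fixpoint crossings (c : lcut) : seq nat :=
  let: LCut n cs := c in
  let l := map crossings cs in
  0%N :: flatten (map (map succn) (take n l)) ++ flatten (drop n l).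

Definition admissible (c : lcut) : bool := all (fun m => m <= 1)%N (crossings c).

Definition LAC (t : otree) : seq lcut := [seq c <- cuts t | admissible c].

Definition LACf (w : oforest) : seq lcut :=
  [seq c <- LAC (Bplus w) | root_cut c == 0%N].

Fixpoint pruned_words (c : lcut) : seq oforest :=
  let: LCut n cs := c in
  nseq (0 < n)%N (FMonom (map cut_tree (take n cs)))
  ++ flatten (map pruned_words cs).

Definition Pcut (k : fieldType) (c : lcut) : Npoly k :=
  \big[@shuffle k/1]_(w <- pruned_words c) << w >>.

Fixpoint Rcut (c : lcut) : otree :=
  let: LCut n cs := c in Node (drop n (map Rcut cs)).

Definition Rcutf (c : lcut) : oforest := Bminus (Rcut c).

Section Equations.
Context (k : fieldType).
Local Notation N := (Npoly k).
Local Notation Ns := (Nseries k).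
Implicit Types (x y z : N) (w v : oforest) (s r : seq otree) (t u : otree).

Lemma wordM s r : word k s * word k r = word k (s ++ r).
Proof. by rewrite word.unlock malgM_def fgmulUU mulr1; congr << _ *g _ >>; exact: fmmulE. Qed.

Lemma word0 : word k [::] = 1.
Proof. by rewrite -[1]/(fgone oforest k) /fgone word.unlock -fmoneE. Qed.

Lemma linext_word (V : lmodType k) (f : oforest -> V) s :
  linext f (word k s) = f (FMonom s).
Proof. by rewrite word.unlock linextU. Qed.

Lemma eq_linext (V : lmodType k) (f g : oforest -> V) x :
  (forall w, x@_w != 0 -> f w = g w) -> linext f x = linext g x.
Proof.
move=> E; rewrite linext.unlock !big_seq; apply: eq_bigr => w Hw.
by rewrite E // mcoeff_neq0.
Qed.

Lemma linext_comb (V : lmodType k) (f g : oforest -> V) c x :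
  linext (fun w => c *: f w + g w) x = c *: linext f x + linext g x.
Proof.
rewrite linext.unlock scaler_sumr -big_split /=; apply: eq_bigr => w _.
by rewrite scalerDr !scalerA mulrC.
Qed.

Section Homogeneity.
Context (d : oforest -> nat).
Context (dM : forall s r,
  d (FMonom (s ++ r)) = (d (FMonom s) + d (FMonom r))%N).

Definition homog (n : nat) x : Prop := forall w, x@_w != 0 -> d w = n.

Lemma homogU n c w : d w = n -> homog n << c *g w >>.
Proof. move=> <- v; by rewrite mcoeffU; case: (w =P v) => [->|_] //; rewrite eqxx. Qed.

Lemma homog_word n s : d (FMonom s) = n -> homog n (word k s).
Proof. by rewrite word.unlock => /homogU. Qed.

Lemma homog0 n : homog n 0.
Proof. by move=> w; rewrite mcoeff0 eqxx. Qed.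

Lemma homogD n x y : homog n x -> homog n y -> homog n (x + y).
Proof.
move=> Hx Hy w; rewrite mcoeffD; case: (eqVneq x@_w 0) => [->|/Hx //].
by rewrite add0r => /Hy.
Qed.

Lemma homogZ n c x : homog n x -> homog n (c *: x).
Proof. by move=> Hx w; rewrite mcoeffZ mulf_eq0 negb_or => /andP[_ /Hx]. Qed.

Lemma homogN n x : homog n x -> homog n (- x).
Proof. by move=> Hx w; rewrite mcoeffN oppr_eq0 => /Hx. Qed.

Lemma homog_sum n (I : eqType) (l : seq I) (F : I -> N) :
  (forall i, i \in l -> homog n (F i)) -> homog n (\sum_(i <- l) F i).
Proof.
move=> H; rewrite big_seq; apply: (big_ind (homog n)) => //.
- exact: homog0.
- exact: homogD.
Qed.

Lemma homog_linext n (f : oforest -> N) x :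
  (forall w, x@_w != 0 -> homog n (f w)) -> homog n (linext f x).
Proof.
move=> H; rewrite linext.unlock; apply: homog_sum => w; rewrite -mcoeff_neq0 => Hw.
by apply: homogZ; apply: H.
Qed.

Lemma homogM m n x y : homog m x -> homog n y -> homog (m + n) (x * y).
Proof.
move=> Hx Hy; rewrite malgME; apply: homog_sum => w; rewrite -mcoeff_neq0 => Hw.
apply: homog_sum => v; rewrite -mcoeff_neq0 => Hv; apply: homogU.
rewrite -(Hx _ Hw) -(Hy _ Hv).
by case: w {Hw} => sw; case: v {Hv} => sv; rewrite -dM; congr d; exact: fmmulE.
Qed.

End Homogeneity.

Definition wlen (w : oforest) : nat := size w.

Lemma wlenM s r : wlen (FMonom (s ++ r)) = (wlen (FMonom s) + wlen (FMonom r))%N.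
Proof. exact: size_cat. Qed.

Lemma vertM s r : vert (FMonom (s ++ r)) = (vert (FMonom s) + vert (FMonom r))%N.
Proof. by rewrite /vert /= map_cat sumn_cat. Qed.

Lemma graft_treeE t s :
  graft_tree k t (Node s) = word k [:: Node (t :: s)] + BplusN (graft_word k t s).
Proof. by []. Qed.

Lemma homog_BplusN n x : homog vert n x -> homog vert n.+1 (BplusN x).
Proof.
move=> Hx; apply: homog_linext => w Hw; apply: homog_word.
by rewrite -(Hx _ Hw) /vert /= addn0.
Qed.

Lemma homog_graft_word t s :
  homog wlen (size s) (graft_word k t s) /\
  homog vert (tvert t + vert (FMonom s)) (graft_word k t s).
Proof.
pose P u := homog wlen 1 (graft_tree k t u) /\
            homog vert (tvert t + tvert u) (graft_tree k t u).
pose Q s := homog wlen (size s) (graft_word k t s) /\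
  homog vert (tvert t + vert (FMonom s)) (graft_word k t s).
suff [_ H] : (forall u, P u) /\ (forall s, Q s) by exact: H.
apply: otree_forest_ind => [{}s [_ Hv]| |u {}s [Pl Pv] [Ql Qv]].
- split; rewrite graft_treeE.
    apply: homogD; first exact: homog_word.
    by apply: homog_linext => w _; apply: homog_word.
  apply: homogD; last by rewrite /= addnS; apply: homog_BplusN.
  by apply: homog_word; rewrite /vert /= addn0 addnS.
- by split; apply: homog0.
split; rewrite [graft_word _ _ _]/=.
  apply: homogD; rewrite -[size _]/(1 + size s)%N; apply: homogM => //;
    try exact: wlenM; exact: homog_word.
apply: homogD; rewrite /vert /= -/(vert (FMonom s)).
  by rewrite addnA; apply: homogM => //; [exact: vertM|exact: homog_word].
rewrite addnCA; apply: homogM => //; first exact: vertM.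
by apply: homog_word; rewrite /vert /= addn0.
Qed.

Lemma graft_rec_linear n s c x y :
  graft_rec n s (c *: x + y) = c *: graft_rec n s x + graft_rec n s y.
Proof.
elim: n s c x y => [|n IH] [|t s] c x y //=; rewrite IH linearP.
rewrite (@eq_linext _ _ (fun w => c *: graft_rec n w x + graft_rec n w y)).
  by rewrite linext_comb scalerBr addrACA opprD.
by move=> w _; apply: IH.
Qed.

Lemma graftDl c x y z : graft (c *: x + y) z = c *: graft x z + graft y z.
Proof. by rewrite graft.unlock linearP. Qed.

Lemma graftDr c x y z : graft z (c *: x + y) = c *: graft z x + graft z y.
Proof.
rewrite graft.unlock -linext_comb; apply: eq_linext => w _.
exact: graft_rec_linear.
Qed.

Lemma graft_wordE s y : graft (word k s) y = graft_rec (size s) s y.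
Proof. by rewrite graft.unlock linext_word. Qed.

Lemma graft_recS n t s y :
  graft_rec n.+1 (t :: s) y =
   linext (graft_word k t) (graft_rec n s y)
   - linext (fun w => graft_rec n w y) (graft_word k t s).
Proof. exact: erefl. Qed.

Lemma graft1 y : graft 1 y = y.
Proof. by rewrite -word0 graft_wordE. Qed.

Lemma graft_treeN t y : graft (word k [:: t]) y = linext (graft_word k t) y.
Proof.
rewrite graft_wordE /=.
by rewrite [X in _ - X](_ : _ = 0) ?subr0 // raddf0.
Qed.

Lemma graft_tree_word t s : graft (word k [:: t]) (word k s) = graft_word k t s.
Proof. by rewrite graft_treeN linext_word. Qed.

Lemma graft_tree1 t : graft (word k [:: t]) 1 = 0.
Proof. by rewrite -word0 graft_tree_word. Qed.

Lemma graft_cons t s y :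
  graft (word k (t :: s)) y =
  graft (word k [:: t]) (graft (word k s) y)
  - graft (graft (word k [:: t]) (word k s)) y.
Proof.
rewrite graft_tree_word graft_treeN !graft_wordE [size _]/= graft_recS.
have E : graft (graft_word k t s) y =
    linext (fun w => graft_rec (size s) w y) (graft_word k t s).
  rewrite graft.unlock; apply: eq_linext => w Hw.
  by have [/(_ w Hw) <- _] := homog_graft_word t s.
by rewrite E.
Qed.

Lemma leibniz_aux (R : nzRingType) (A W S D G E : R) :
  A * (S * D) + W * (G * D + S * E) = (A * S + W * G) * D + W * S * E.
Proof. by rewrite mulrDr mulrDl !mulrA addrA. Qed.

Lemma graft_word_cons t u s :
  graft_word k t (u :: s) =
  graft_tree k t u * word k s + word k [:: u] * graft_word k t s.
Proof. exact: erefl. Qed.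

Lemma graft_word_cat t s r :
  graft_word k t (s ++ r) =
  graft_word k t s * word k r + word k s * graft_word k t r.
Proof.
elim: s => [|u s IH].
  by rewrite mul0r add0r word0 mul1r.
rewrite cat_cons !graft_word_cons IH -(wordM s r) -(wordM [:: u] s).
exact: leibniz_aux.
Qed.

Lemma graft_tree_cat t s r :
  graft (word k [:: t]) (word k (s ++ r)) =
  graft (word k [:: t]) (word k s) * word k r
  + word k s * graft (word k [:: t]) (word k r).
Proof.
rewrite (graft_tree_word t s) (graft_tree_word t r) (graft_tree_word t (s ++ r)).
exact: graft_word_cat.
Qed.

Lemma BplusN_word s : BplusN (word k s) = word k [:: Node s].
Proof. by rewrite /BplusN linext_word. Qed.

Lemma graft_bullet x : graft x (word k [:: Node [::]]) = BplusN x.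
Proof.
suff H n s : size s = n ->
    graft (word k s) (word k [:: Node [::]]) = word k [:: Node s].
  rewrite graft.unlock; apply: eq_linext => -[s] _.
  by rewrite -graft_wordE (H _ _ erefl).
elim: n s => [|n IH] [|t s] //; first by rewrite word0 graft1.
case=> Es; rewrite graft_cons IH // graft_tree_word /=.
rewrite word0 mulr1 mulr0 addr0 -/(graft_word k t s) -graft_treeE.
rewrite graft_treeE graft_tree_word.
have -> : graft (graft_word k t s) (word k [:: Node [::]]) =
    BplusN (graft_word k t s).
  rewrite graft.unlock; apply: eq_linext => -[r] Hr; rewrite -graft_wordE IH //.
  by have [/(_ _ Hr)] := homog_graft_word t s; rewrite Es.
by rewrite addrK.
Qed.

Lemma homog_graft m n x y : homog vert m x -> homog vert n y ->
  homog vert (m + n) (graft x y).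
Proof.
move=> Hx Hy; rewrite graft.unlock; apply: homog_linext => w /Hx <- {x Hx}.
suff H l s : size s = l ->
    homog vert (vert (FMonom s) + n) (graft_rec l s y).
  by case: w => s; apply: H.
elim: l s => [|l IH] [|t s] //= [] Es.
apply: homogD; last apply: homogN.
  apply: homog_linext => v Hv.
  have [_] := homog_graft_word t v; rewrite fmK (IH _ Es _ Hv).
  by rewrite /vert /= addnA.
apply: homog_linext => v Hv; have [Hl] := homog_graft_word t s.
move=> /(_ _ Hv) E; have {}Hl := Hl _ Hv; rewrite [vert _]/= -/(vert (FMonom s)).
by rewrite /vert /= -[sumn _]/(vert (FMonom s)) -E; case: v Hl {Hv E} => r Hr; apply: IH; rewrite -Es -Hr.
Qed.

Lemma mcoeff_hcomp n (a : Ns) w : (hcomp n a)@_w = if vert w == n then a w else 0.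
Proof.
rewrite hcomp.unlock raddf_sum -mem_forests; case: ifP => Hw.
  rewrite (big_fsetD1 w) //= mcoeffUU big_seq big1 ?addr0 // => v.
  by rewrite !inE => /andP[/negbTE nvw _]; rewrite mcoeffU nvw.
rewrite big_seq big1 // => v Hv; rewrite [LHS]mcoeffU.
by case: eqP Hv => [->|]; rewrite ?Hw.
Qed.

Lemma homog_hcomp n (a : Ns) : homog vert n (hcomp n a).
Proof. by move=> w; rewrite mcoeff_hcomp; case: (eqVneq (vert w) n) => // _; rewrite eqxx. Qed.

Lemma homog_mcoeff n x w : homog vert n x -> vert w != n -> x@_w = 0.
Proof. by move=> Hx Hw; apply: contraNeq Hw => /Hx ->. Qed.

Definition graded (op : N -> N -> N) : Prop := forall m n x y,
  homog vert m x -> homog vert n y -> homog vert (m + n) (op x y).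

Lemma gradedM : graded *%R.
Proof. by move=> m n x y; apply: homogM; exact: vertM. Qed.

Lemma hcomp_gext2 op n (a b : Ns) : graded op ->
  hcomp n (gext2 op a b) = \sum_(i < n.+1) op (hcomp i a) (hcomp (n - i) b).
Proof.
move=> gop; apply/malgP => w; rewrite mcoeff_hcomp /gext2.
case: eqP => [<-//|/eqP nw]; symmetry; apply: (@homog_mcoeff n) => //.
apply: homog_sum => i _; rewrite -[X in homog _ X](@subnKC i n) -1?ltnS //.
by apply: gop; exact: homog_hcomp.
Qed.

Lemma eq_hcomp n (a b : Ns) : a =1 b -> hcomp n a = hcomp n b.
Proof. by move=> E; rewrite hcomp.unlock; apply: eq_bigr => w _; rewrite E. Qed.

Lemma hcompP (a b : Ns) : (forall n, hcomp n a = hcomp n b) -> a =1 b.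
Proof.
by move=> E w; have /malgP/(_ w) := E (vert w); rewrite !mcoeff_hcomp eqxx.
Qed.

Lemma eq_gext2 op (a a' b b' : Ns) :
  a =1 a' -> b =1 b' -> gext2 op a b =1 gext2 op a' b'.
Proof.
move=> Ea Eb w; rewrite /gext2; congr mcoeff; apply: eq_bigr => i _.
by rewrite (eq_hcomp _ Ea) (eq_hcomp _ Eb).
Qed.

Lemma triangle_sum (V : zmodType) (n : nat) (F : nat -> nat -> V) :
  \sum_(i < n.+1) \sum_(j < (n - i).+1) F i j =
  \sum_(m < n.+1) \sum_(i < m.+1) F i (m - i)%N.
Proof.
elim: n => [|n IH]; first by rewrite !big_ord1.
rewrite [RHS]big_ord_recr /= -IH big_ord_recr /= subnn big_ord1.
rewrite [X in _ = _ + X]big_ord_recr /= subnn addrA -big_split /=.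
congr (_ + _); apply: eq_bigr => i _.
by rewrite subSn -1?ltnS // big_ord_recr.
Qed.

Lemma triangle_assoc (R : nzRingType) (n : nat) (A B C : nat -> R) :
  \sum_(i < n.+1) A i * (\sum_(j < (n - i).+1) B j * C (n - i - j)%N) =
  \sum_(m < n.+1) (\sum_(i < m.+1) A i * B (m - i)%N) * C (n - m)%N.
Proof.
pose F i j := A i * B j * C (n - (i + j))%N.
transitivity (\sum_(i < n.+1) \sum_(j < (n - i).+1) F i j).
  by apply: eq_bigr => i _; rewrite mulr_sumr; apply: eq_bigr => j _;
    rewrite mulrA -subnDA.
rewrite triangle_sum; apply: eq_bigr => m _.
by rewrite mulr_suml; apply: eq_bigr => i _; rewrite /F subnKC // -ltnS.
Qed.

Lemma hcomp_smul n (a b : Ns) :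
  hcomp n (smul a b) = \sum_(i < n.+1) hcomp i a * hcomp (n - i) b.
Proof. exact: hcomp_gext2 gradedM. Qed.

Lemma hcomp_sgraft n (a b : Ns) :
  hcomp n (sgraft a b) = \sum_(i < n.+1) graft (hcomp i a) (hcomp (n - i) b).
Proof. exact: hcomp_gext2 homog_graft. Qed.

Lemma smulA (a b c : Ns) : smul a (smul b c) =1 smul (smul a b) c.
Proof.
apply: hcompP => n.
have E := @triangle_assoc N n (fun l => hcomp l a) (fun l => hcomp l b)
            (fun l => hcomp l c).
apply: (etrans (hcomp_smul n a (smul b c))).
apply: (etrans _ (esym (hcomp_smul n (smul a b) c))).
apply: (etrans _ (etrans E _)).
apply: eq_bigr => i _.
by rewrite (hcomp_smul (n - i) b c).
apply: eq_bigr => i _.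
by rewrite (hcomp_smul i a b).
Qed.

Lemma hcomp_sone n : hcomp n (@sone k) = if n == 0%N then 1 else 0.
Proof.
apply/malgP => w; rewrite mcoeff_hcomp /sone.
case: (eqVneq n 0%N) => [->|n0]; last first.
  rewrite mcoeff0; case: ifP => // /eqP E; case: (w =P mone) => // w1.
  by case/eqP: n0; rewrite -E w1 -[mone]/(fmone otree) fmoneE.
rewrite mcoeff1; case: ifP => // /negbT E; case: eqP => // w1.
by case/negP: E; rewrite w1 -[mone]/(fmone otree) fmoneE.
Qed.

Lemma smul1 (a : Ns) : smul (@sone k) a =1 a.
Proof.
apply: hcompP => n; rewrite hcomp_smul.
rewrite big_ord_recl big1 ?addr0; last by move=> i _; rewrite hcomp_sone mul0r.
by rewrite hcomp_sone mul1r subn0.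
Qed.

Lemma subst_word_cat (a : Ns) s r :
  subst_word a (s ++ r) =1 smul (subst_word a s) (subst_word a r).
Proof.
elim: s => [|u s IH] w /=; first by rewrite smul1.
by rewrite -smulA; apply: eq_gext2.
Qed.

Lemma subst_tree_Node (a : Ns) s :
  subst_tree a (Node s) = sgraft (subst_word a s) a.
Proof. by []. Qed.

Lemma lie_poly_mcoeff0 x : lie_poly x -> x@_mone = 0.
Proof.
elim=> [t||y z _ Hy _ Hz|c y _ Hy|y z _ Hy _ Hz].
- rewrite word.unlock mcoeffU; case: eqP => // E.
  by have := congr1 (fun m : oforest => size m) E; rewrite fm1.
- by rewrite mcoeff0.
- by rewrite mcoeffD Hy Hz addr0.
- by rewrite mcoeffZ Hy mulr0.
have [H _] := @mcoeff1g_is_multiplicative oforest k.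
have E1 : (y * z)@_mone = 0 by apply: etrans (H y z) _; rewrite Hy mul0r.
have E2 : (z * y)@_mone = 0 by apply: etrans (H z y) _; rewrite Hy mulr0.
apply: etrans (mcoeffB _ _ _) _.
exact: etrans (congr2 (fun p q => p - q) E1 E2) (subr0 _).
Qed.

Lemma vert_mone : vert mone = 0%N.
Proof. by rewrite -[mone]/(fmone otree) fmoneE. Qed.

Lemma lie_series0 (a : Ns) : lie_series a -> hcomp 0 a = 0.
Proof.
move=> Ha; apply/malgP => w; rewrite mcoeff_hcomp mcoeff0; case: ifP => // Hw.
have := lie_poly_mcoeff0 (Ha 0%N); rewrite mcoeff_hcomp vert_mone eqxx => <-.
congr a; case: w Hw => -[|[s] r] // _.
by rewrite -[mone]/(fmone otree) fmoneE.
Qed.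

Lemma hcomp_gext2_low op m n (a b : Ns) l :
  graded op -> (forall x, op 0 x = 0) -> (forall x, op x 0 = 0) ->
  (forall i, (i < m)%N -> hcomp i a = 0) ->
  (forall i, (i < n)%N -> hcomp i b = 0) ->
  (l < m + n)%N -> hcomp l (gext2 op a b) = 0.
Proof.
move=> gop op0 op0' Ha Hb lt_l; rewrite hcomp_gext2 // big1 // => i _.
case: (ltnP i m) => [/Ha->|le_mi]; first by rewrite op0.
rewrite Hb ?op0' //; have := ltn_ord i; lia.
Qed.

Lemma graft0l y : graft 0 y = 0.
Proof. by rewrite graft.unlock raddf0. Qed.

Lemma graft0r y : graft y 0 = 0.
Proof.
by have := graftDr (-1) 0 0 y; rewrite scaler0 addr0 scaleN1r addNr.
Qed.

Lemma subst_word_low (a : Ns) : lie_series a -> forall s l,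
  (l < vert (FMonom s))%N -> hcomp l (subst_word a s) = 0.
Proof.
move=> Ha; pose P t := forall l, (l < tvert t)%N -> hcomp l (subst_tree a t) = 0.
pose Q s := forall l, (l < vert (FMonom s))%N -> hcomp l (subst_word a s) = 0.
suff [_ H] : (forall t, P t) /\ (forall s, Q s) by exact: H.
apply: otree_forest_ind => [s Hs l|//|t s Ht Hs l].
  rewrite subst_tree_Node /= -[sumn _]/(vert (FMonom s)) => lt_l.
  apply: (hcomp_gext2_low (m := vert (FMonom s)) (n := 1)) => //.
  - exact: homog_graft.
  - exact: graft0l.
  - exact: graft0r.
  - by case=> // _; apply: lie_series0.
  - by rewrite addn1.
move=> lt_l; apply: (hcomp_gext2_low gradedM _ _ Ht Hs lt_l).
- exact: mul0r.
- exact: mulr0.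
Qed.

Lemma subst_word_eq0 (a : Ns) v w : lie_series a -> (vert w < vert v)%N ->
  subst_word a v w = 0.
Proof.
case: v => s Ha /(subst_word_low Ha)/malgP/(_ w).
by rewrite mcoeff_hcomp eqxx mcoeff0.
Qed.

Lemma subst_basis (a : Ns) v : lie_series a ->
  subst a (fun w => (w == v)%:R) =1 subst_word a v.
Proof.
move=> Ha w; rewrite /subst.
case: (ltnP (vert w) (vert v)) => [lt_wv|le_vw].
  rewrite subst_word_eq0 // big1 // => i _; rewrite big_seq big1 // => u.
  rewrite mem_forests => /eqP Eu; case: eqP => [E|_]; last by rewrite mul0r.
  by have := ltn_ord i; rewrite -Eu E; lia.
rewrite (bigD1 (Ordinal (le_vw : vert v < (vert w).+1)%N)) //=.
rewrite (big_fsetD1 v) ?mem_forests //= eqxx mul1r big_seq big1 ?addr0.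
  rewrite big1 ?addr0 // => i ne_i; rewrite big_seq big1 // => u.
  rewrite mem_forests => /eqP Eu; case: eqP => [E|_]; last by rewrite mul0r.
  by case/eqP: ne_i; apply: val_inj; rewrite /= -Eu E.
by move=> u; rewrite !inE => /andP[/negbTE-> _]; rewrite mul0r.
Qed.

Lemma subst_bullet (a : Ns) : subst_tree a (Node [::]) =1 a.
Proof.
apply: hcompP => n; rewrite subst_tree_Node hcomp_sgraft.
rewrite big_ord_recl big1 ?addr0.
  by rewrite hcomp_sone subn0 graft1.
by move=> i _; rewrite hcomp_sone graft0l.
Qed.

Lemma pairingE (b : Ns) x : pairing b x = linext (V := k^o) b x.
Proof. by rewrite linext.unlock. Qed.

Lemma linext_linear (V W : lmodType k) (g : {linear V -> W}) (f : oforest -> V) x :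
  g (linext f x) = linext (fun w => g (f w)) x.
Proof.
by rewrite !linext.unlock linear_sum; apply: eq_bigr => w _; rewrite linearZ.
Qed.

Lemma pairingU (b : Ns) c w : pairing b << c *g w >> = b w * c.
Proof.
have -> : << c *g w >> = c *: << w >> :> N.
  by apply/malgP => v; rewrite mcoeffZ !mcoeffU mulrnAr mulr1.
by rewrite pairingE linearZ /= linextU -[LHS]/(c * b w) mulrC.
Qed.

Lemma subst_dual_exists (a : Ns) : exists aT : N -> N, subst_dual a aT.
Proof.
exists (linext (fun w =>
  \sum_(i < (vert w).+1) \sum_(v <- forests i) << subst_word a v w *g v >>)).
move=> b x; rewrite [RHS]pairingE linext_linear pairingE.
apply: (@eq_linext k^o) => w _; rewrite linear_sum; apply: eq_bigr => i _.
rewrite linear_sum; apply: eq_bigr => v _.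
by rewrite -[RHS]pairingE pairingU.
Qed.

Lemma subst_dual_unique (a : Ns) (aT aT' : N -> N) :
  subst_dual a aT -> subst_dual a aT' -> aT =1 aT'.
Proof.
move=> H H' x; apply/malgP => w.
have pw y : pairing (fun v => (w == v)%:R) y = y@_w.
  rewrite [in RHS](monalgE y) raddf_sum; apply: eq_bigr => v _.
  by rewrite [RHS]mcoeffU eq_sym mulr_natr.
by rewrite -!pw -H H'.
Qed.

End Equations.

Fixpoint cut_wf (c : lcut) : bool :=
  let: LCut n cs := c in (n <= size cs)%N && all cut_wf cs.

Fixpoint lcut_ind' (P : lcut -> Prop) (Q : seq lcut -> Prop)
    (PN : forall n s, Q s -> P (LCut n s)) (Q0 : Q [::])
    (QS : forall c s, P c -> Q s -> Q (c :: s)) (c : lcut) : P c :=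
  let: LCut n s := c in
  PN n s ((fix loop s : Q s :=
    if s is d :: s' then QS d s' (lcut_ind' PN Q0 QS d) (loop s') else Q0) s).

Fixpoint lcut_enc (c : lcut) : GenTree.tree unit :=
  let: LCut n s := c in GenTree.Node n (map lcut_enc s).
Fixpoint lcut_dec (g : GenTree.tree unit) : lcut :=
  if g is GenTree.Node n s then LCut n (map lcut_dec s) else LCut 0 [::].

Lemma lcut_encK : cancel lcut_enc lcut_dec.
Proof.
apply: (lcut_ind' (Q := fun s => map lcut_dec (map lcut_enc s) = s)) => //.
- by move=> n s /= ->.
- by move=> c s /= -> ->.
Qed.

HB.instance Definition _ := Countable.copy lcut (can_type lcut_encK).

Definition cuts_word (s : seq otree) : seq (seq lcut) :=
  foldr (fun l ls => [seq c :: cs | c <- l, cs <- ls]) [:: [::]] (map cuts s).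

Lemma mem_cuts c t : (c \in cuts t) = cut_wf c && (cut_tree c == t).
Proof.
pose P c := forall t, (c \in cuts t) = cut_wf c && (cut_tree c == t).
pose Q cs := forall s, (cs \in cuts_word s) =
  all cut_wf cs && (map cut_tree cs == s).
move: c t; apply: (@lcut_ind' P Q) => [n cs IH [s]|[|t s] //|c cs IHc IH [|t s]].
- apply/allpairsP/idP => [[[m ds] /= [Hm Hds [? ?]]]|/= /andP[/andP[Hn Hw] /eqP[E]]].
    subst m ds; move: Hds; rewrite -/(cuts_word s) IH => /andP[-> /eqP E].
    by move: Hm; rewrite (mem_iota 0 (size s).+1) add0n ltnS -E size_map eqxx andbT /= => ->.
  exists (n, cs); split=> //=; last by rewrite -/(cuts_word s) IH Hw E eqxx.
  by rewrite (mem_iota 0 (size s).+1) add0n ltnS -E size_map.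
- by apply/negbTE/allpairsP => -[[? ?] [_ _]].
- by rewrite /cuts_word /= inE /= andbF.
apply/allpairsP/idP => [[[d ds] /= [Hd Hds [? ?]]]|/= /andP[/andP[Hc Hcs] /eqP[E1 E2]]].
  subst d ds; rewrite IHc in Hd; rewrite IH in Hds.
  by case/andP: Hd => /= -> /eqP->; case/andP: Hds => -> /eqP->; rewrite eqxx.
by exists (c, cs); split=> //=; rewrite ?IHc ?IH ?Hc ?Hcs ?E1 ?E2 eqxx.
Qed.

Lemma cuts_uniq t : uniq (cuts t).
Proof.
move: t; apply: (@otree_ind' (fun t => uniq (cuts t)) (fun s => uniq (cuts_word s))) => [s Hs||t s Ht Hs] //.
- by apply: allpairs_uniq => //; [exact: iota_uniq|move=> [? ?] [? ?] _ _ [-> ->]].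
- by apply: allpairs_uniq => // -[? ?] [? ?] _ _ [-> ->].
Qed.

(* Main.v *)
Require Import Defs.
From mathcomp Require Import all_boot all_order all_algebra.
From mathcomp Require Import finmap zify.

(** The coefficient of a forest [v] in the dual of substitution applied to [w]
    is the coefficient of [w] in the series [a * v], so both sides are compared
    coefficient by coefficient.  Write a nonempty [v] as [v' B^+(u)], splitting
    off its last tree.  Substitution is a D-algebra morphism, hence
    [a * v = (a * v') ((a * u) ~> a)], and two dualities turn this product into
    the recursion.

    Concatenation is dual to deconcatenation ([smulE]): this gives the outer sum
    over [w = w_1 w_2], with [a * v'] read on [w_1] and [(a * u) ~> a] read on
    [w_2].

    Grafting is dual to left admissible cuts ([sgraftE]): the coefficient of [w]
    in [b ~> a] is the sum, over the left admissible cuts [c] of [w], of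
    [<b, P^c(w)> a(R^c(w))].  The combinatorial picture is that the word [s]
    grafted onto [r] attaches every tree of [s] to some vertex of [r], to the
    left of the branches already there and keeping the order of [s] among the
    trees that land on one vertex; a cut of [w] undoes such a grafting, and the
    words cut off at the various vertices are shuffled because their relative
    order in [s] is free.

    The picture is made rigorous by structural recursion on both sides.  The
    recursive definition of grafting removes the first tree of the left operand
    and has a correction term, so it says little about the shape of the result;
    [graft_unshuffle] converts it into two rules that recurse on the right
    operand and distribute [s] by unshuffling: a product receives part of [s] in
    each factor ([graft_wordM]), and [B^+(x)] receives part of [s] at the root,
    to the left, and the rest inside [x] ([graft_word_Bplus]).  The cuts obey
    the transposed rules ([dual_graft_cons], [dual_graft_Node]): cuts of a word
    are chosen tree by tree, and a cut of a tree removes the [n] leftmost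
    branches and then cuts the word of remaining branches.  Induction on the
    forest that is cut identifies the two ([mcoeff_graft_word]). *)

Set Implicit Arguments.
Unset Strict Implicit.
Unset Printing Implicit Defensive.

Import GRing.Theory.
Local Open Scope ring_scope.

(** * Bilinear expansions on words *)

Section LinearAlgebra.
Context (k : fieldType).
Local Notation N := (Npoly k).
Local Notation Ns := (Nseries k).

Lemma coefD (x y : N) w : (x + y)@_w = x@_w + y@_w.
Proof. exact: mcoeffD. Qed.

Lemma coef_sum (I : Type) (l : seq I) (P : pred I) (F : I -> N) w :
  (\sum_(i <- l | P i) F i)@_w = \sum_(i <- l | P i) (F i)@_w.
Proof. exact: raddf_sum. Qed.

Lemma monomial_scale c w : << c *g w >> = c *: << w >> :> N.
Proof. by apply/malgP => v; rewrite mcoeffZ mcoeffU mcoeffU1 mulr_natr. Qed.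

Lemma scalar_pairing (f : N -> k) : scalar f ->
  forall x, f x = pairing (fun w => f << w >>) x.
Proof.
move=> Hf x.
have f0 : f 0 = 0 by have := Hf (-1) 0 0; rewrite scaler0 addr0 mulN1r addNr.
have fD : {morph f : y z / y + z}.
  by move=> y z; have := Hf 1 y z; rewrite scale1r mul1r.
rewrite {1}[x]monalgE (big_morph f fD f0); apply: eq_bigr => w _.
by rewrite monomial_scale -[X in f X]addr0 Hf f0 addr0.
Qed.

Lemma mul_scaler (c : k) (x y : N) : x * (c *: y) = c *: (x * y).
Proof.
rewrite [x * y]malgME (malgMEw (fsubset_refl _) (msuppZ_le c y)) scaler_sumr.
apply: eq_bigr => v _; rewrite scaler_sumr; apply: eq_bigr => u _.
rewrite mcoeffZ mulrCA (monomial_scale (c * _)) (monomial_scale (x@_v * _)).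
by rewrite scalerA.
Qed.

Lemma eq_pairing (b c : Ns) (x : N) : b =1 c -> pairing b x = pairing c x.
Proof. by move=> E; apply: eq_bigr => w _; rewrite E. Qed.

Lemma pairing_basis w (x : N) : pairing (fun v => (v == w)%:R) x = x@_w.
Proof.
rewrite [in RHS](monalgE x) raddf_sum; apply: eq_bigr => v _.
by rewrite monomial_scale [RHS]mcoeffZ mcoeffU1.
Qed.

Lemma pairing_sum (I : Type) (l : seq I) (c : I -> k) (b : I -> Ns) x :
  pairing (fun w => \sum_(i <- l) c i * b i w) x =
  \sum_(i <- l) c i * pairing (b i) x.
Proof.
rewrite /pairing; under eq_bigr => w _ do rewrite mulr_sumr.
rewrite exchange_big; apply: eq_bigr => i _; rewrite mulr_sumr.
by apply: eq_bigr => w _; rewrite mulrCA.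
Qed.

Lemma pairingC (x y : N) : pairing (fun w => x@_w) y = pairing (fun w => y@_w) x.
Proof.
rewrite /pairing.
transitivity (\sum_(w <- (msupp x `|` msupp y)%fset) y@_w * x@_w).
  apply/big_fset_incl; first exact: fsubsetUr.
  by move=> w _ Hw; rewrite (mcoeff_outdom Hw) mul0r.
symmetry; transitivity (\sum_(w <- (msupp x `|` msupp y)%fset) x@_w * y@_w).
  apply/big_fset_incl; first exact: fsubsetUl.
  by move=> w _ Hw; rewrite (mcoeff_outdom Hw) mul0r.
by apply: eq_bigr => w _; rewrite mulrC.
Qed.

(** Transposition: a bilinear operation is known from its values on pairs of
    forests, so a formula for those values that is a sum of products of one
    function of each operand holds for all operands, the functions becoming
    pairings.  Multiplication, shuffle and grafting are all dualised this way. *)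
Lemma bilinear_expansion (op : N -> N -> N) (w : oforest)
    (I : Type) (l : seq I) (f g : I -> Ns) :
  (forall c x y z, op (c *: x + y) z = c *: op x z + op y z) ->
  (forall c x y z, op z (c *: x + y) = c *: op z x + op z y) ->
  (forall v u, (op << v >> << u >>)@_w = \sum_(i <- l) f i v * g i u) ->
  forall x y, (op x y)@_w = \sum_(i <- l) pairing (f i) x * pairing (g i) y.
Proof.
move=> opl opr E x y.
have Hl z : scalar (fun x' => (op x' z)@_w).
  by move=> c x1 x2; rewrite opl mcoeffD mcoeffZ.
have Hr z : scalar (fun y' => (op z y')@_w).
  by move=> c y1 y2; rewrite opr mcoeffD mcoeffZ.
rewrite (scalar_pairing (Hl y)).
under [RHS]eq_bigr => i _ do rewrite mulrC.
rewrite -pairing_sum; apply: eq_pairing => v.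
rewrite (scalar_pairing (Hr _)).
under [RHS]eq_bigr => i _ do rewrite mulrC.
rewrite -pairing_sum; apply: eq_pairing => u; exact: E.
Qed.

End LinearAlgebra.

Section Unshuffles.
Context (T : Type).
Implicit Types (s : seq T).

(** All ways to distribute the letters of a word over two subwords, with
    multiplicity: the coproduct dual to the shuffle product. *)
Fixpoint unshuffles (s : seq T) : seq (seq T * seq T) :=
  if s is t :: s' then
    [seq (t :: p.1, p.2) | p <- unshuffles s']
    ++ [seq (p.1, t :: p.2) | p <- unshuffles s']
  else [:: ([::], [::])].

Context (V : nmodType).

Lemma unshuffles_nil (F : seq T * seq T -> V) :
  \sum_(p <- unshuffles [::]) F p = F ([::], [::]).
Proof. exact: big_seq1. Qed.

Lemma unshuffles_cons (F : seq T * seq T -> V) t s :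
  \sum_(p <- unshuffles (t :: s)) F p =
  \sum_(p <- unshuffles s) F (t :: p.1, p.2)
  + \sum_(p <- unshuffles s) F (p.1, t :: p.2).
Proof. by rewrite /= big_cat !big_map. Qed.

Lemma unshuffles_coassoc (F : seq T -> seq T -> seq T -> V) s :
  \sum_(p <- unshuffles s) \sum_(q <- unshuffles p.2) F p.1 q.1 q.2 =
  \sum_(p <- unshuffles s) \sum_(q <- unshuffles p.1) F q.1 q.2 p.2.
Proof.
elim: s F => [|t s IH] F; first by rewrite !unshuffles_nil.
rewrite !unshuffles_cons /=.
under [X in _ + X = _]eq_bigr => p _ do rewrite unshuffles_cons.
under [X in _ = X + _]eq_bigr => p _ do rewrite unshuffles_cons.
by rewrite !big_split /= (IH (fun a b c => F (t :: a) b c))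
  (IH (fun a b c => F a (t :: b) c)) (IH (fun a b c => F a b (t :: c))) !addrA.
Qed.
End Unshuffles.
Arguments unshuffles : simpl never.

Section Counit.
Context (T : eqType) (R : pzSemiRingType).

Lemma unshuffles_counitl (F : seq T -> R) s :
  \sum_(p <- unshuffles s) (p.1 == [::])%:R * F p.2 = F s.
Proof.
elim: s F => [|t s IH] F; first by rewrite unshuffles_nil eqxx mul1r.
rewrite unshuffles_cons /= big1 ?add0r => [|p _]; first exact: (IH (fun p => F (t :: p))).
by rewrite mul0r.
Qed.

Lemma unshuffles_counitr (F : seq T -> R) s :
  \sum_(p <- unshuffles s) F p.1 * (p.2 == [::])%:R = F s.
Proof.
elim: s F => [|t s IH] F; first by rewrite unshuffles_nil eqxx mulr1.
rewrite unshuffles_cons /= addrC big1 ?add0r => [|p _]; first exact: (IH (fun p => F (t :: p))).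
by rewrite mulr0.
Qed.
End Counit.

Section Coefficients.
Context (k : fieldType).
Local Notation N := (Npoly k).
Local Notation word := (word k).

Lemma mcoeff_word s r : (word s)@_(FMonom r) = (s == r)%:R.
Proof. by rewrite word.unlock mcoeffU1. Qed.

Lemma mcoeff_treeM t s x :
  (word [:: t] * x)@_(FMonom s) =
  if s is u :: s' then (t == u)%:R * x@_(FMonom s') else 0.
Proof.
pose f := fun x : N => (word [:: t] * x)@_(FMonom s).
pose g := fun x : N => if s is u :: s' then (t == u)%:R * x@_(FMonom s') else 0.
have Hf : scalar f by move=> c y z; rewrite /f mulrDr mul_scaler mcoeffD mcoeffZ.
have Hg : scalar g.
  rewrite /g; case: s {f g Hf} => [|u s] c y z; first by rewrite mulr0 addr0.
  by rewrite mcoeffD mcoeffZ mulrDr mulrCA.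
rewrite -/(f x) -/(g x) (scalar_pairing Hf) (scalar_pairing Hg).
apply: eq_pairing => -[r]; have E : << FMonom r >> = word r by rewrite word.unlock.
rewrite /f /g E wordM mcoeff_word; case: s {f g Hf Hg} => [|u s] //=.
by rewrite mcoeff_word eqseq_cons -natrM mulnb.
Qed.

Lemma shuffle_word_cons t s u r :
  shuffle_word k (t :: s) (u :: r) =
  word [:: t] * shuffle_word k s (u :: r) + word [:: u] * shuffle_word k (t :: s) r.
Proof. by []. Qed.

Lemma mcoeff_shuffle_word s r v :
  (shuffle_word k s r)@_(FMonom v) =
  \sum_(p <- unshuffles v) (s == p.1)%:R * (r == p.2)%:R.
Proof.
elim: v s r => [|x v IH] [|t s] [|u r].
- by rewrite unshuffles_nil mcoeff_word mulr1.
- by rewrite unshuffles_nil mcoeff_word mulr0.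
- by rewrite unshuffles_nil mcoeff_word mul0r.
- rewrite unshuffles_nil mul0r shuffle_word_cons coefD -[RHS]addr0.
  by congr (_ + _); rewrite mcoeff_treeM.
- under eq_bigr => p _ do rewrite eq_sym.
  rewrite -[LHS]/((word [::])@_(FMonom (x :: v))) mcoeff_word.
  by rewrite (unshuffles_counitl (fun q => ([::] == q)%:R)).
- under eq_bigr => p _ do rewrite eq_sym.
  rewrite -[LHS]/((word (u :: r))@_(FMonom (x :: v))) mcoeff_word.
  by rewrite (unshuffles_counitl (fun q => (u :: r == q)%:R)).
- under eq_bigr => p _ do rewrite [_ == p.2]eq_sym.
  rewrite -[LHS]/((word (t :: s))@_(FMonom (x :: v))) mcoeff_word.
  by rewrite (unshuffles_counitr (fun q => (t :: s == q)%:R)).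
rewrite unshuffles_cons shuffle_word_cons.
have E (a b : N) : (word [:: t] * a + word [:: u] * b)@_(FMonom (x :: v)) =
    (t == x)%:R * a@_(FMonom v) + (u == x)%:R * b@_(FMonom v).
  by rewrite coefD; congr (_ + _); rewrite mcoeff_treeM.
rewrite E (IH s) (IH (t :: s)) !mulr_sumr.
congr (_ + _); apply: eq_bigr => p _ /=; rewrite eqseq_cons.
  by rewrite mulrA; congr (_ * _); rewrite -natrM mulnb.
by rewrite mulrCA; congr (_ * _); rewrite -natrM mulnb.
Qed.

Lemma shuffleDl c (x y z : N) :
  shuffle (c *: x + y) z = c *: shuffle x z + shuffle y z.
Proof. by rewrite /shuffle linearP. Qed.

Lemma shuffleDr c (x y z : N) :
  shuffle z (c *: x + y) = c *: shuffle z x + shuffle z y.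
Proof. rewrite /shuffle -linext_comb; apply: eq_linext => w _.
exact: (linext_is_linear (shuffle_word k w) c x y). Qed.

Lemma mcoeff_shuffle x y s :
  (shuffle x y : N)@_(FMonom s) =
  \sum_(p <- unshuffles s) x@_(FMonom p.1) * y@_(FMonom p.2).
Proof.
rewrite (@bilinear_expansion _ _ _ _ (unshuffles s)
  (fun p v => (v == FMonom p.1)%:R) (fun p v => (v == FMonom p.2)%:R)).
- by apply: eq_bigr => p _; rewrite !pairing_basis.
- exact: shuffleDl.
- exact: shuffleDr.
by move=> v u; rewrite /shuffle !linextU mcoeff_shuffle_word.
Qed.

Lemma mcoeff_mul x y s :
  (x * y : N)@_(FMonom s) =
  \sum_(i <- iota 0 (size s).+1) x@_(FMonom (take i s)) * y@_(FMonom (drop i s)).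
Proof.
rewrite (@bilinear_expansion _ *%R _ _ (iota 0 (size s).+1)
  (fun i v => (v == FMonom (take i s))%:R) (fun i v => (v == FMonom (drop i s))%:R)).
- by apply: eq_bigr => p _; rewrite !pairing_basis.
- by move=> c x1 x2 z; rewrite mulrDl -scalerAl.
- by move=> c x1 x2 z; rewrite mulrDr mul_scaler.
move=> [v] [u]; have E r : << FMonom r >> = word r by rewrite word.unlock.
rewrite !E wordM mcoeff_word.
have Ei i : ((FMonom v == FMonom (take i s))%:R * (FMonom u == FMonom (drop i s))%:R)
  = ((v == take i s) && (u == drop i s))%:R :> k by rewrite -natrM mulnb.
under eq_bigr => i _ do rewrite Ei.
have [Es|ne] := eqVneq (v ++ u) s; last first.
  rewrite big1 // => i _; case: andP => // -[/eqP Ev /eqP Eu].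
  by rewrite Ev Eu cat_take_drop eqxx in ne.
subst s; have Hv : size v \in iota 0 (size (v ++ u)).+1.
  by rewrite mem_iota add0n ltnS size_cat leq_addr.
rewrite (bigD1_seq _ Hv) ?iota_uniq //.
rewrite take_size_cat // drop_size_cat // !eqxx big_seq_cond.
rewrite big1 => [|i]; first exact: esym (addr0 _).
rewrite mem_iota add0n ltnS => /andP[/andP[_ Hi] ne].
case: andP => // -[/eqP Ev _]; case/eqP: ne.
by rewrite Ev size_takel.
Qed.

End Coefficients.

(** * Grafting a word, distributed by unshuffling *)

(** The grafting onto a single tree is a parameter, so that the recursion on
    trees can pass through the recursion on words. *)
Definition graft_on_one (G : otree -> seq otree) : seq otree -> seq (seq otree) :=
  fix L s := if s is v :: s' then
    [seq v' :: s' | v' <- G v] ++ [seq v :: r | r <- L s'] else [::].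

(** The trees obtained by attaching [t] as leftmost branch at some vertex of [u],
    one for each vertex. *)
Fixpoint tree_graftings (t u : otree) : seq otree :=
  let: Node s := u in
  Node (t :: s) :: map Node (graft_on_one (tree_graftings t) s).

Definition word_graftings (t : otree) (s : seq otree) : seq (seq otree) :=
  graft_on_one (tree_graftings t) s.

Lemma word_graftings_cons t u s : word_graftings t (u :: s) =
  [seq v :: s | v <- tree_graftings t u] ++ [seq u :: r | r <- word_graftings t s].
Proof. by []. Qed.

Arguments word_graftings : simpl never.

Lemma size_word_graftings t s r : r \in word_graftings t s -> size r = size s.
Proof.
elim: s r => [|u s IH] r //; rewrite word_graftings_cons mem_cat.
by case/orP=> /mapP[v Hv ->] //=; rewrite (IH _ Hv).
Qed.

Section UnshuffleGrafting.
Context (V : nmodType).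

(** Grafting a tree is a coderivation of the unshuffle coproduct: the letter of
    [s] that receives [t] ends up in one of the two subwords. *)
Lemma unshuffles_grafting (B : seq otree -> seq otree -> V) t s :
  \sum_(r <- word_graftings t s) \sum_(p <- unshuffles r) B p.1 p.2 =
  \sum_(p <- unshuffles s) (\sum_(q <- word_graftings t p.1) B q p.2
                            + \sum_(q <- word_graftings t p.2) B p.1 q).
Proof.
elim: s B => [|u s IH] B.
  by rewrite unshuffles_nil /= !big_nil addr0.
rewrite word_graftings_cons big_cat !big_map unshuffles_cons /=.
under eq_bigr => v _ do rewrite unshuffles_cons /=.
under [X in _ + X]eq_bigr => r _ do rewrite unshuffles_cons /=.
rewrite !big_split /= (IH (fun a b => B (u :: a) b)) (IH (fun a b => B a (u :: b))).
rewrite !big_split /=.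
under [X in _ = X + _ + _]eq_bigr => p _ do rewrite word_graftings_cons big_cat !big_map /=.
under [X in _ = _ + (_ + X)]eq_bigr => p _ do rewrite word_graftings_cons big_cat !big_map /=.
rewrite !big_split /= [X in X + _ + _ = _]exchange_big.
rewrite [X in _ + X + _ = _]exchange_big.
rewrite /= -!addrA; congr (_ + _).
by do 3![rewrite addrCA; congr (_ + _)].
Qed.
End UnshuffleGrafting.

Section Grafting.
Context (k : fieldType).
Local Notation N := (Npoly k).
Local Notation word := (word k).

Lemma BplusN_linear c (x y : N) : BplusN (c *: x + y) = c *: BplusN x + BplusN y.
Proof. exact: linext_is_linear. Qed.

Lemma linear_map_sum (f : N -> N) (Hf : linear f) (I : Type) (l : seq I) (F : I -> N) :
  f (\sum_(i <- l) F i) = \sum_(i <- l) f (F i).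
Proof.
have f0 : f 0 = 0 by have := Hf (-1) 0 0; rewrite scaler0 addr0 scaleN1r addNr.
by apply: (big_morph f _ f0) => x y; have := Hf 1 x y; rewrite !scale1r.
Qed.

Lemma graft_suml (I : Type) (l : seq I) (F : I -> N) (y : N) :
  graft (\sum_(i <- l) F i) y = \sum_(i <- l) graft (F i) y.
Proof. exact: (linear_map_sum (fun c u v => graftDl c u v y)). Qed.

Lemma graft_sumr (I : Type) (l : seq I) (F : I -> N) (y : N) :
  graft y (\sum_(i <- l) F i) = \sum_(i <- l) graft y (F i).
Proof. exact: (linear_map_sum (fun c u v => graftDr c u v y)). Qed.

Lemma BplusN_sum (I : Type) (l : seq I) (F : I -> N) :
  BplusN (\sum_(i <- l) F i) = \sum_(i <- l) BplusN (F i).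
Proof. exact: (linear_map_sum BplusN_linear). Qed.

Lemma BplusND (x y : N) : BplusN (x + y) = BplusN x + BplusN y.
Proof. exact: raddfD. Qed.

Lemma graft_word_sum t s :
  graft_word k t s = \sum_(r <- word_graftings t s) word r.
Proof.
pose P u := graft_tree k t u = \sum_(v <- tree_graftings t u) word [:: v].
pose Q s := graft_word k t s = \sum_(r <- word_graftings t s) word r.
suff [_ H] : (forall u, P u) /\ (forall s, Q s) by exact: H.
apply: otree_forest_ind => [{}s Hs| |u {}s Hu Hs].
- rewrite /P graft_treeE Hs (linear_map_sum BplusN_linear) big_cons big_map.
  by congr (_ + _); apply: eq_bigr => r _; rewrite BplusN_word.
- by rewrite /Q big_nil.
rewrite /Q graft_word_cons Hu Hs word_graftings_cons big_cat !big_map.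
rewrite mulr_suml mulr_sumr.
by congr (_ + _); apply: eq_bigr => r _; rewrite wordM.
Qed.

Lemma graft_consE t s (y : N) :
  graft (word [:: t]) (graft (word s) y) =
  graft (word (t :: s)) y + \sum_(r <- word_graftings t s) graft (word r) y.
Proof.
by rewrite (graft_cons t s) graft_tree_word graft_word_sum graft_suml addrNK.
Qed.

Lemma linear_eq (f g : N -> N) : linear f -> linear g ->
  (forall s, f (word s) = g (word s)) -> f =1 g.
Proof.
move=> Hf Hg E x; rewrite [x]monalgE !linear_map_sum //; apply: eq_bigr => -[s] _.
have f0 : f 0 = 0 by have := Hf (-1) 0 0; rewrite scaler0 addr0 scaleN1r addNr.
have g0 : g 0 = 0 by have := Hg (-1) 0 0; rewrite scaler0 addr0 scaleN1r addNr.
have Es : << FMonom s >> = word s by rewrite word.unlock.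
rewrite monomial_scale -[X in f X]addr0 -[X in g X]addr0 Hf Hg Es E.
by rewrite f0 g0.
Qed.

Lemma graft_tree_mul t (x y : N) :
  graft (word [:: t]) (x * y) =
  graft (word [:: t]) x * y + x * graft (word [:: t]) y.
Proof.
move: x; apply: linear_eq => [c u v|c u v|s].
- by rewrite mulrDl -scalerAl graftDr.
- by rewrite graftDr !mulrDl -(scalerAl c (graft _ u)) -(scalerAl c u) scalerDr addrACA.
move: y; apply: linear_eq => [c u v|c u v|r].
- by rewrite mulrDr mul_scaler graftDr.
- by rewrite graftDr !mulrDr !mul_scaler scalerDr addrACA.
by rewrite wordM graft_tree_cat.
Qed.

Lemma graft_tree_Bplus t (x : N) :
  graft (word [:: t]) (BplusN x) =
  BplusN (word [:: t] * x) + BplusN (graft (word [:: t]) x).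
Proof.
move: x; apply: linear_eq => [c u v|c u v|s].
- by rewrite BplusN_linear graftDr.
- by rewrite graftDr mulrDr mul_scaler !BplusN_linear scalerDr addrACA.
rewrite wordM !BplusN_word !graft_tree_word graft_word_cons word0 mulr1.
by rewrite [graft_word k t [::]]/= mulr0 addr0 graft_treeE.
Qed.

(** Suppose that grafting one tree onto [B p q] either prepends it to [p] or to
    [q], or grafts it onto a letter of [p] or of [q].  The last two kinds of
    terms are, by [unshuffles_grafting], exactly the correction term
    [(t ~> s) ~> x] in the definition of [(t s) ~> x]; what remains adds [t] to
    one of the two subwords, which is how the unshuffles of [t s] arise. *)
Lemma graft_unshuffle (B : seq otree -> seq otree -> N) :
  (forall t p q, graft (word [:: t]) (B p q) =
     B (t :: p) q + B p (t :: q)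
     + (\sum_(r <- word_graftings t p) B r q
        + \sum_(r <- word_graftings t q) B p r)) ->
  forall s, graft (word s) (B [::] [::]) = \sum_(p <- unshuffles s) B p.1 p.2.
Proof.
move=> HB s; elim: (size s) {-2}s (erefl (size s)) => {s} [|n IH] [|t s] // Es.
  by rewrite word0 graft1 unshuffles_nil.
have {}Es : size s = n by case: Es.
have Er : \sum_(r <- word_graftings t s) graft (word r) (B [::] [::]) =
    \sum_(r <- word_graftings t s) \sum_(p <- unshuffles r) B p.1 p.2.
  apply: eq_big_seq => r Hr; apply: IH.
  by rewrite (size_word_graftings Hr).
apply: (addIr (\sum_(r <- word_graftings t s) graft (word r) (B [::] [::]))).
rewrite -graft_consE (IH s Es) graft_sumr Er (unshuffles_grafting B).
by rewrite unshuffles_cons -!big_split; apply: eq_bigr => p _; apply: HB.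
Qed.

Lemma graft_wordM s (x y : N) :
  graft (word s) (x * y) =
  \sum_(p <- unshuffles s) graft (word p.1) x * graft (word p.2) y.
Proof.
pose B p q := graft (word p) x * graft (word q) y.
have B0 : B [::] [::] = x * y by rewrite /B word0 !graft1.
rewrite -B0; apply: graft_unshuffle => t p q.
rewrite /B graft_tree_mul !graft_consE !mulrDl !mulrDr.
by rewrite mulr_suml mulr_sumr addrACA.
Qed.

Lemma graft_word_Bplus s (x : N) :
  graft (word s) (BplusN x) =
  \sum_(p <- unshuffles s) BplusN (word p.1 * graft (word p.2) x).
Proof.
pose B p q := BplusN (word p * graft (word q) x).
have B0 : B [::] [::] = BplusN x by rewrite /B word0 graft1 mul1r.
rewrite -B0; apply: graft_unshuffle => t p q; rewrite /B.
have -> : graft (word [:: t]) (BplusN (word p * graft (word q) x)) =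
    BplusN (word (t :: p) * graft (word q) x) +
    BplusN (word p * graft (word (t :: q)) x +
      (\sum_(r <- word_graftings t p) word r * graft (word q) x +
       \sum_(r <- word_graftings t q) word p * graft (word r) x)).
  rewrite graft_tree_Bplus mulrA wordM graft_tree_mul graft_consE.
  rewrite graft_tree_word graft_word_sum mulr_suml mulrDr mulr_sumr.
  by congr (_ + BplusN _); rewrite addrCA.
rewrite -addrA; congr (_ + _); apply: etrans (BplusND _ _) _; congr (_ + _).
by apply: etrans (BplusND _ _) _; congr (_ + _); apply: BplusN_sum.
Qed.

(** Nothing can be attached to the empty forest. *)
Lemma graft_word_one s : graft (word s) 1 = (s == [::])%:R :> N.
Proof.
elim: (size s) {-2}s (erefl (size s)) => {s} [|n IH] [|t s] // Es.
  by rewrite word0 graft1.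
have {}Es : size s = n by case: Es.
have := graft_consE t s 1; rewrite (IH s Es).
have -> : graft (word [:: t]) (s == [::])%:R = 0.
  by case: eqP => _; rewrite ?graft_tree1 ?graft0r.
rewrite big_seq big1 ?addr0 => [<-|r Hr] //.
rewrite (IH r (etrans (size_word_graftings Hr) Es)).
by case: s Hr {Es} => // u s /size_word_graftings; case: r.
Qed.

End Grafting.

(** * Left admissible cuts *)

(** The Cartesian product through which [cuts] treats the branches of a vertex,
    isolated so that it can also be taken of their admissible cuts. *)
Definition choices (T : Type) (ls : seq (seq T)) : seq (seq T) :=
  foldr (fun l ls => [seq c :: cs | c <- l, cs <- ls]) [:: [::]] ls.

Lemma choices_cons (T : Type) (l : seq T) ls :
  choices (l :: ls) = [seq c :: cs | c <- l, cs <- choices ls].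
Proof. by []. Qed.

Arguments choices : simpl never.

Lemma eq_Node r s : (Node r == Node s) = (r == s).
Proof. by apply/eqP/eqP => [[]|->]. Qed.

Lemma filter_product (T : Type) (p : pred T) (q : pred (seq T))
    (l : seq T) (ls : seq (seq T)) :
  [seq x <- [seq c :: cs | c <- l, cs <- ls] |
     if x is c :: cs then p c && q cs else true] =
  [seq c :: cs | c <- [seq c <- l | p c], cs <- [seq cs <- ls | q cs]].
Proof.
elim: l => [|c l IH] //=; rewrite filter_cat IH filter_map.
have -> : [seq cs <- ls | preim (cons c)
    (fun x => if x is c :: cs then p c && q cs else true) cs] =
    [seq cs <- ls | p c && q cs] by apply: eq_filter.
by case: (p c) => //=; rewrite filter_pred0.
Qed.

Fixpoint trivial_cut (t : otree) : lcut :=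
  let: Node s := t in LCut 0 (map trivial_cut s).

Definition uncut (c : lcut) : bool := all (fun m => m == 0)%N (crossings c).

Lemma all_flatten (T : Type) (p : pred T) (ss : seq (seq T)) :
  all p (flatten ss) = all (all p) ss.
Proof. by elim: ss => //= s ss <-; rewrite all_cat. Qed.

(** Below a removed edge nothing more may be cut; below the other edges the only
    condition is admissibility. *)
Lemma admissibleE n cs : admissible (LCut n cs) =
  all uncut (take n cs) && all admissible (drop n cs).
Proof.
rewrite /admissible /= all_cat !all_flatten -!map_take -!map_drop !all_map.
by congr (_ && _); apply: eq_all => c /=; rewrite all_map; apply: eq_all; case.
Qed.

Lemma uncutE n cs : uncut (LCut n cs) =
  nilp (take n cs) && all uncut (drop n cs).
Proof.
rewrite /uncut /= all_cat !all_flatten -!map_take -!map_drop !all_map.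
by congr (_ && _); case: (take n cs) => [|[m ds] l].
Qed.

Lemma uncut_trivial_cut c : cut_wf c -> uncut c -> c = trivial_cut (cut_tree c).
Proof.
pose Q cs := all cut_wf cs -> all uncut cs -> cs = map trivial_cut (map cut_tree cs).
move: c; apply: (lcut_ind' (Q := Q)) => [n cs IH||c cs IHc IHcs] //=.
- case/andP=> Hn Hcs; rewrite uncutE => /andP[Hnil].
  have -> : n = 0%N.
    by apply/eqP; move: Hnil; rewrite /nilp size_takel.
  by rewrite drop0 => /(IH Hcs) {1}->.
- move=> /andP[wc wcs] /andP[uc ucs].
  by rewrite /= -(IHc wc uc) -(IHcs wcs ucs).
Qed.

Lemma cut_tree_trivial t : cut_tree (trivial_cut t) = t.
Proof.
move: t; apply: (otree_ind' (Q := fun s => map cut_tree (map trivial_cut s) = s)) => //=.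
- by move=> s ->.
- by move=> t s -> ->.
Qed.

Lemma map_cut_tree_trivial s : map cut_tree (map trivial_cut s) = s.
Proof. by rewrite -map_comp -[RHS]map_id; apply: eq_map => t; apply: cut_tree_trivial. Qed.

Lemma pruned_words_trivial s :
  flatten (map pruned_words (map trivial_cut s)) = [::].
Proof.
pose P t := pruned_words (trivial_cut t) = [::].
suff [_ H] : (forall t, P t) /\
    (forall s, flatten (map pruned_words (map trivial_cut s)) = [::]) by [].
by apply: otree_forest_ind => //= t {}s -> ->.
Qed.

Lemma trivial_cutP t : cut_wf (trivial_cut t) && uncut (trivial_cut t).
Proof.
move: t; apply: (otree_ind' (Q := fun s =>
  all cut_wf (map trivial_cut s) && all uncut (map trivial_cut s))) => //=.
- by move=> s /andP[ws us]; rewrite uncutE take0 drop0 ws us.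
- by move=> t s /andP[-> ->] /andP[-> ->].
Qed.

(** Only the empty cut is crossed by no path, and it is enumerated once. *)
Lemma filter_uncut_cuts t : [seq c <- cuts t | uncut c] = [:: trivial_cut t].
Proof.
have /andP[wt ut] := trivial_cutP t.
have mem_t : trivial_cut t \in cuts t by rewrite mem_cuts wt cut_tree_trivial eqxx.
rewrite -(filter_pred1_uniq (cuts_uniq t) mem_t); apply: eq_in_filter => c.
rewrite mem_cuts => /andP[wc /eqP Ec] /=; apply/idP/eqP => [uc|-> //].
by rewrite (uncut_trivial_cut wc uc) Ec.
Qed.

Definition lac_word (s : seq otree) : seq (seq lcut) := choices (map LAC s).

Lemma cuts_word_cons t s :
  cuts_word (t :: s) = [seq c :: cs | c <- cuts t, cs <- cuts_word s].
Proof. by []. Qed.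

Lemma filter_admissible_cuts s :
  [seq cs <- cuts_word s | all admissible cs] = lac_word s.
Proof.
elim: s => [|t s IH] //.
rewrite cuts_word_cons /lac_word map_cons choices_cons -/(lac_word s) -IH.
by rewrite /LAC -filter_product; apply: eq_filter; case.
Qed.

Lemma filter_cuts_word n s :
  [seq cs <- cuts_word s | all uncut (take n cs) && all admissible (drop n cs)] =
  [seq map trivial_cut (take n s) ++ cs | cs <- lac_word (drop n s)].
Proof.
elim: s n => [|t s IH] [|n] //.
  rewrite take0 drop0 /= map_id -filter_admissible_cuts.
  by apply: eq_filter => cs; rewrite take0 drop0.
transitivity [seq c :: cs | c <- [:: trivial_cut t], cs <-
    [seq map trivial_cut (take n s) ++ cs | cs <- lac_word (drop n s)]].
  rewrite -(IH n) -filter_uncut_cuts -filter_product cuts_word_cons.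
  by apply: eq_filter => -[|c cs] //=; rewrite andbA.
by rewrite /= cats0 -map_comp.
Qed.

(** Since a path crosses at most one elementary cut, the [n] branches removed at
    the root are left whole, while the others carry any admissible cuts. *)
Lemma LAC_Node s : LAC (Node s) =
  [seq LCut n (map trivial_cut (take n s) ++ cs)
  | n <- iota 0 (size s).+1, cs <- lac_word (drop n s)].
Proof.
have -> : LAC (Node s) = [seq c <- [seq LCut n cs
  | n <- iota 0 (size s).+1, cs <- cuts_word s] | admissible c] by [].
rewrite filter_flatten -map_comp; congr flatten; apply: eq_map => n /=.
rewrite filter_map (eq_filter (a2 := fun cs =>
  all uncut (take n cs) && all admissible (drop n cs))); last first.
  by move=> cs; apply: admissibleE.
by rewrite filter_cuts_word -map_comp.
Qed.

Lemma LACf_word w : LACf w = [seq LCut 0 cs | cs <- lac_word w].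
Proof.
rewrite /LACf /Bplus LAC_Node /= filter_cat drop0.
have -> : [seq x <- [seq LCut 0 ([seq trivial_cut i | i <- take 0 w] ++ cs)
    | cs <- lac_word w] | root_cut x == 0%N] = [seq LCut 0 cs | cs <- lac_word w].
  by rewrite take0 /= filter_map; apply/congr1/all_filterP/allP.
rewrite -[RHS]cats0; congr (_ ++ _).
rewrite filter_flatten -map_comp.
have H (n : nat) : n \in iota 1 (size w) -> [seq c <- [seq LCut n
    ([seq trivial_cut i | i <- take n w] ++ cs) | cs <- lac_word (drop n w)]
    | root_cut c == 0%N] = [::].
  rewrite mem_iota => /andP[n_gt0 _]; rewrite filter_map.
  rewrite (eq_filter (a2 := pred0)) ?filter_pred0 // => cs /=.
  by case: n n_gt0.
rewrite (eq_in_map _ (fun _ => [::]) _).1 => [|n /H //].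
by elim: (iota _ _).
Qed.

Definition pruned (cs : seq lcut) : seq oforest := flatten (map pruned_words cs).

Lemma Rcut_cut_at n w cs : (n <= size w)%N ->
  Rcut (LCut n (map trivial_cut (take n w) ++ cs)) = Node (map Rcut cs).
Proof. by move=> le_nw; rewrite /= map_cat drop_size_cat // !size_map size_takel. Qed.

Lemma pruned_words_cut_at n w cs : (n <= size w)%N ->
  pruned_words (LCut n (map trivial_cut (take n w) ++ cs)) =
  nseq (0 < n)%N (FMonom (take n w)) ++ pruned cs.
Proof.
move=> le_nw; rewrite /= take_size_cat ?size_map ?size_takel //.
by rewrite map_cut_tree_trivial map_cat flatten_cat pruned_words_trivial.
Qed.

Section KeyLemma.
Context (k : fieldType).
Local Notation N := (Npoly k).
Local Notation word := (word k).

Definition shuffle_words (l : seq oforest) : N :=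
  \big[@shuffle k/1]_(w <- l) << w >>.

Lemma mcoeff_one s : (1 : N)@_(FMonom s) = (s == [::])%:R.
Proof. by rewrite -word0 mcoeff_word eq_sym. Qed.

(** Coassociativity of unshuffling replaces associativity of the shuffle
    product. *)
Lemma mcoeff_shuffle_words_cat l1 l2 s :
  (shuffle_words (l1 ++ l2))@_(FMonom s) =
  \sum_(p <- unshuffles s) (shuffle_words l1)@_(FMonom p.1)
                           * (shuffle_words l2)@_(FMonom p.2).
Proof.
elim: l1 s => [|w l1 IH] s.
  under eq_bigr => p _ do rewrite /shuffle_words big_nil mcoeff_one.
  by rewrite (unshuffles_counitl (fun q => (shuffle_words l2)@_(FMonom q))).
rewrite /shuffle_words big_cons -/(shuffle_words (l1 ++ l2)) mcoeff_shuffle.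
under eq_bigr => p _ do rewrite IH mulr_sumr.
rewrite (unshuffles_coassoc (fun a b c => << w >>@_(FMonom a) *
  ((shuffle_words l1)@_(FMonom b) * (shuffle_words l2)@_(FMonom c)))).
apply: eq_bigr => p _; rewrite big_cons mcoeff_shuffle mulr_suml.
by apply: eq_bigr => q _; rewrite mulrA.
Qed.

Lemma mcoeff_shuffle_words1 w s : (shuffle_words [:: FMonom w])@_(FMonom s) = (w == s)%:R.
Proof.
rewrite /shuffle_words big_cons big_nil mcoeff_shuffle.
under eq_bigr => p _ do rewrite mcoeff_one mcoeffU1.
by rewrite (unshuffles_counitr (fun q => (FMonom w == FMonom q)%:R)).
Qed.

Lemma mcoeff_Bplus_mul (x y : N) s :
  (BplusN x * y)@_(FMonom s) =
  if s is Node r :: s' then x@_(FMonom r) * y@_(FMonom s') else 0.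
Proof.
pose f := fun x : N => (BplusN x * y)@_(FMonom s).
pose g := fun x : N => if s is Node r :: s' then x@_(FMonom r) * y@_(FMonom s') else 0.
have Hf : scalar f.
  by move=> c u v; rewrite /f BplusN_linear mulrDl -scalerAl mcoeffD mcoeffZ.
have Hg : scalar g.
  rewrite /g; case: s {f g Hf} => [|[r] s] c u v; first by rewrite mulr0 addr0.
  by rewrite mcoeffD mcoeffZ mulrDl mulrA.
rewrite -/(f x) -/(g x) (scalar_pairing Hf) (scalar_pairing Hg).
apply: eq_pairing => -[r]; have E : << FMonom r >> = word r by rewrite word.unlock.
rewrite /f /g E BplusN_word mcoeff_treeM; case: s {f g Hf Hg} => [|[q] s] //=.
by rewrite mcoeff_word eq_Node.
Qed.

Lemma mcoeff_Bplus (x : N) s :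
  (BplusN x)@_(FMonom s) = if s is [:: Node r] then x@_(FMonom r) else 0.
Proof.
rewrite -[BplusN x]mulr1 mcoeff_Bplus_mul; case: s => [|[r] [|u s]] //;
  by rewrite mcoeff_one ?mulr1 ?mulr0.
Qed.

(** What cuts predict for the coefficient of [w] in [s ~> r]. *)
Definition dual_graft (s r w : seq otree) : k :=
  \sum_(cs <- lac_word w)
     (map Rcut cs == r)%:R * (shuffle_words (pruned cs))@_(FMonom s).

Definition dual_graft_tree (s : seq otree) (u v : otree) : k :=
  \sum_(c <- LAC v) (Rcut c == u)%:R * (Pcut k c)@_(FMonom s).

Lemma dual_graft_nil s r : dual_graft s r [::] = ((r == [::]) && (s == [::]))%:R.
Proof.
rewrite /dual_graft big_seq1 /pruned /shuffle_words big_nil mcoeff_one.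
by rewrite -natrM mulnb eq_sym.
Qed.

(** Cuts of a word are chosen tree by tree and their pruned parts are shuffled. *)
Lemma dual_graft_cons s r v w : dual_graft s r (v :: w) =
  if r is u :: r' then
    \sum_(p <- unshuffles s) dual_graft_tree p.1 u v * dual_graft p.2 r' w
  else 0.
Proof.
rewrite /dual_graft /lac_word map_cons choices_cons -/(lac_word w) big_allpairs_dep.
case: r => [|u r] /=; first by rewrite big1 // => c _; rewrite big1 // => cs _; rewrite mul0r.
under [RHS]eq_bigr => p _ do rewrite /dual_graft_tree /dual_graft mulr_suml.
rewrite [RHS]exchange_big; apply: eq_bigr => c _.
under [RHS]eq_bigr => p _ do rewrite mulr_sumr.
rewrite [RHS]exchange_big; apply: eq_bigr => cs _.
rewrite eqseq_cons -mulnb natrM /pruned /= mcoeff_shuffle_words_cat mulr_sumr.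
by apply: eq_bigr => p _; rewrite mulrACA.
Qed.

(** The [n] branches removed at the root form one of the shuffled words; for
    [n = 0] this is the empty word, the unit of the shuffle product. *)
Lemma dual_graft_Node s q w : dual_graft_tree s (Node q) (Node w) =
  \sum_(n <- iota 0 (size w).+1) \sum_(p <- unshuffles s)
    (p.1 == take n w)%:R * dual_graft p.2 q (drop n w).
Proof.
rewrite /dual_graft_tree LAC_Node big_allpairs_dep; apply: eq_big_seq => n.
rewrite mem_iota add0n ltnS => /andP[_ le_nw].
under [RHS]eq_bigr => p _ do rewrite /dual_graft mulr_sumr.
rewrite [RHS]exchange_big; apply: eq_bigr => cs _.
rewrite Rcut_cut_at // eq_Node /Pcut pruned_words_cut_at //.
rewrite -/(shuffle_words _) mcoeff_shuffle_words_cat mulr_sumr.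
apply: eq_bigr => p _; rewrite mulrCA; congr (_ * _).
case: n {le_nw} => [|n]; last by rewrite mcoeff_shuffle_words1 eq_sym.
by rewrite take0 /shuffle_words big_nil mcoeff_one.
Qed.

(** Grafting is dual to cutting.  Grafting onto a word and onto a tree satisfies
    [graft_wordM] and [graft_word_Bplus], whose coefficients are the right-hand
    sides of [dual_graft_cons] and [dual_graft_Node]. *)
Lemma mcoeff_graft_word s r w :
  (graft (word s) (word r))@_(FMonom w) = dual_graft s r w.
Proof.
pose P v := forall s u, (graft (word s) (word [:: u]))@_(FMonom [:: v]) =
  dual_graft_tree s u v.
(* Cutting at the root leaves a suffix of the word of branches, so the induction
   hypothesis has to cover all suffixes. *)
pose Q w := forall n s r, (graft (word s) (word r))@_(FMonom (drop n w)) =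
  dual_graft s r (drop n w).
suff [_ H] : (forall v, P v) /\ (forall w, Q w) by have := H w 0%N; rewrite drop0; apply.
have Qnil r' s' : (graft (word s') (word r'))@_(FMonom [::]) = dual_graft s' r' [::].
  rewrite dual_graft_nil; case: r' => [|[q] r'] /=.
    rewrite word0 graft_word_one; case: (s' == [::]); first exact: mcoeff_one.
    exact: mcoeff0.
  rewrite -[Node q :: r']/([:: Node q] ++ r') -wordM graft_wordM raddf_sum big1 //.
  by move=> p _; rewrite -BplusN_word graft_word_Bplus -BplusN_sum; apply: mcoeff_Bplus_mul.
apply: otree_forest_ind => [{}w Hw {}s [q]|n {}s {}r|v {}w Hv Hw [|n] {}s {}r].
- rewrite dual_graft_Node -BplusN_word graft_word_Bplus raddf_sum exchange_big.
  apply: eq_bigr => p _; rewrite [LHS]mcoeff_Bplus mcoeff_mul; apply: eq_bigr => n _.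
  by rewrite mcoeff_word Hw.
- exact: Qnil.
- rewrite drop0 dual_graft_cons; case: r => [|[q] r].
    rewrite word0 graft_word_one; case: (s == [::]); last exact: mcoeff0.
    exact: mcoeff_one.
  rewrite -[Node q :: r]/([:: Node q] ++ r) -wordM graft_wordM raddf_sum.
  apply: eq_bigr => p _; rewrite -Hv -(drop0 w) -Hw drop0.
  rewrite -BplusN_word graft_word_Bplus -BplusN_sum.
  apply: etrans (mcoeff_Bplus_mul _ _ _) _; case: v {Hv} => v.
  by rewrite mcoeff_Bplus.
- exact: Hw.
Qed.

End KeyLemma.

(** * Grading and series *)

(** Cutting only redistributes vertices.  This homogeneity is what lets the
    polynomial duality pass to series degree by degree. *)
Lemma vert_LAC :
  (forall t c, c \in LAC t ->
     tvert t = tvert (Rcut c) + sumn (map vert (pruned_words c)))%N /\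
  (forall w cs, cs \in lac_word w ->
     vert (FMonom w) = vert (FMonom (map Rcut cs)) + sumn (map vert (pruned cs)))%N.
Proof.
pose Q w := forall n cs, cs \in lac_word (drop n w) ->
  (vert (FMonom (drop n w)) = vert (FMonom (map Rcut cs)) + sumn (map vert (pruned cs)))%N.
suff [HP HQ] : (forall t c, c \in LAC t ->
     tvert t = tvert (Rcut c) + sumn (map vert (pruned_words c)))%N /\ (forall w, Q w).
  by split=> // w cs; have := HQ w 0%N cs; rewrite drop0.
apply: otree_forest_ind => [w Hw c|n cs|t w Ht Hw [|n] cs].
- rewrite LAC_Node => /allpairsPdep[n [cs [Hn Hcs ->]]].
  move: Hn; rewrite mem_iota add0n ltnS => /andP[_ le_nw].
  rewrite Rcut_cut_at // pruned_words_cut_at // map_cat sumn_cat.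
  have Ew : vert (FMonom w) = (vert (FMonom (take n w)) + vert (FMonom (drop n w)))%N.
    by rewrite -vertM cat_take_drop.
  have -> : sumn (map vert (nseq (0 < n)%N (FMonom (take n w)))) = vert (FMonom (take n w)).
    by case: n {le_nw Hcs Ew} => [|n] /=; rewrite ?take0 ?addn0.
  rewrite [tvert _]/= -/(vert (FMonom w)) Ew (Hw _ _ Hcs) [tvert (Node _)]/=.
  by rewrite -/(vert (FMonom (map Rcut cs))) addSn addnCA.
- by rewrite inE => /eqP->.
- rewrite drop0 /lac_word map_cons choices_cons => /allpairsP[[c ds] [/= Hc Hds ->]].
  have {}Hds : ds \in lac_word (drop 0 w) by rewrite drop0.
  have := Hw _ _ Hds; rewrite drop0 /vert /pruned /= map_cat sumn_cat => ->.
  by rewrite (Ht _ Hc) addnACA.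
- exact: Hw.
Qed.

Lemma vert_unshuffles s p : p \in unshuffles s ->
  vert (FMonom s) = (vert (FMonom p.1) + vert (FMonom p.2))%N.
Proof.
elim: s p => [|t s IH] p; first by rewrite inE => /eqP->.
rewrite mem_cat => /orP[] /mapP[q /IH E ->]; move: E; rewrite /vert /= => ->.
  by rewrite addnA.
by rewrite addnCA.
Qed.

Section Series.
Context (k : fieldType).
Local Notation N := (Npoly k).
Local Notation Ns := (Nseries k).
Local Notation word := (word k).

Lemma homog_shuffle_words l : homog vert (sumn (map vert l)) (shuffle_words k l).
Proof.
elim: l => [|w l IH] [v].
  by rewrite /shuffle_words big_nil mcoeff_one; case: (v =P [::]) => [->|_] //; rewrite eqxx.
apply: contraNeq => ne; rewrite /shuffle_words big_cons mcoeff_shuffle.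
rewrite big_seq big1 // => p Hp; rewrite mcoeffU1.
case: (w =P _) => [Ew|]; last by rewrite mul0r.
rewrite (homog_mcoeff IH) ?mulr0 //; apply: contraNneq ne => E.
by rewrite (vert_unshuffles Hp) /= Ew E.
Qed.

Lemma mcoeff_graft (x y : N) w :
  (graft x y)@_(FMonom w) =
  \sum_(cs <- lac_word w) pairing (fun v => (shuffle_words k (pruned cs))@_v) x
                          * y@_(FMonom (map Rcut cs)).
Proof.
rewrite (@bilinear_expansion _ _ _ _ (lac_word w)
  (fun cs v => (shuffle_words k (pruned cs))@_v)
  (fun cs v => (v == FMonom (map Rcut cs))%:R)).
- by apply: eq_bigr => cs _; rewrite pairing_basis.
- exact: graftDl.
- exact: graftDr.
move=> [v] [u]; have E r : << FMonom r >> = word r by rewrite word.unlock.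
rewrite !E mcoeff_graft_word /dual_graft; apply: eq_bigr => cs _.
by rewrite mulrC eq_sym.
Qed.

(** In the graded definition of [b ~> a] only one pair of degrees sees a given
    cut: that of the pruned part for [b] and that of the remaining forest for
    [a]. *)
Lemma sgraftE (b a : Ns) w :
  sgraft b a w = \sum_(c <- LACf w) pairing b (Pcut k c) * a (Rcutf c).
Proof.
case: w => w; rewrite LACf_word big_map /sgraft /gext2 coef_sum.
under [LHS]eq_bigr => i _ do rewrite mcoeff_graft.
rewrite exchange_big /=; apply: eq_big_seq => cs Hcs.
have -> : Rcutf (LCut 0 cs) = FMonom (map Rcut cs) by rewrite /Rcutf /= drop0.
set r := FMonom (map Rcut cs).
rewrite -[Pcut _ _]/(shuffle_words k (pruned cs)); set x := shuffle_words _ _.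
set n := vert (FMonom w); set d := sumn (map vert (pruned cs)).
have En : n = (vert r + d)%N by exact: (vert_LAC.2 _ _ Hcs).
have lt_dn : (d < n.+1)%N by rewrite ltnS En leq_addl.
rewrite (bigD1 (Ordinal lt_dn)) //= mcoeff_hcomp (_ : n - d = vert r)%N ?eqxx; last by rewrite En addnK.
rewrite [X in _ + X]big1 ?addr0 => [|i ne_i].
  congr (_ * _); rewrite pairingC; rewrite /pairing !big_seq.
  apply: eq_bigr => v; rewrite -mcoeff_neq0 => /homog_shuffle_words Hv.
  by rewrite mcoeff_hcomp Hv eqxx.
rewrite mcoeff_hcomp; case: eqP => [Er|]; last by rewrite mulr0.
case/eqP: ne_i; apply: val_inj => /=; have := ltn_ord i; lia.
Qed.

Lemma smulE (a b : Ns) w :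
  smul a b w = \sum_(p <- deconc w) a p.1 * b p.2.
Proof.
case: w => w; rewrite /deconc big_map /smul /gext2 coef_sum.
under [LHS]eq_bigr => i _ do rewrite mcoeff_mul.
rewrite exchange_big; apply: eq_bigr => j _ /=.
set r := FMonom (take j w); set s := FMonom (drop j w); set n := vert _.
have En : n = (vert r + vert s)%N by rewrite /n -vertM cat_take_drop.
have lt_rn : (vert r < n.+1)%N by rewrite ltnS En leq_addr.
rewrite (bigD1 (Ordinal lt_rn)) //= !mcoeff_hcomp (_ : n - vert r = vert s)%N ?eqxx; last by rewrite En addKn.
rewrite big1 ?addr0 // => i ne_i; rewrite mcoeff_hcomp.
case: eqP => [Er|]; last by rewrite mul0r.
by case/eqP: ne_i; apply: val_inj.
Qed.

Lemma smuls1 (a : Ns) : smul a (@sone k) =1 a.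
Proof.
apply: hcompP => n; rewrite hcomp_smul big_ord_recr /= subnn hcomp_sone mulr1.
rewrite big1 ?add0r // => i _; rewrite hcomp_sone.
by case: eqP => [E|_]; [have := ltn_ord i; lia|rewrite mulr0].
Qed.

(** The recursion of the theorem, on the side of substitution. *)
Lemma subst_word_rcons (a : Ns) v r w :
  subst_word a (rcons v (Node r)) w =
  \sum_(p <- deconc w) \sum_(c <- LACf p.2)
    a (Rcutf c) * (subst_word a v p.1 * pairing (subst_word a r) (Pcut k c)).
Proof.
rewrite -cats1 subst_word_cat smulE; apply: eq_bigr => p _.
rewrite [X in _ * X]smuls1 subst_tree_Node sgraftE mulr_sumr.
by apply: eq_bigr => c _; rewrite mulrA mulrC.
Qed.

Lemma mcoeff_mul_Bplus (x y : N) v r :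
  (x * BplusN y)@_(FMonom (rcons v (Node r))) = x@_(FMonom v) * y@_(FMonom r).
Proof.
rewrite (@bilinear_expansion _ (fun x y => x * BplusN y) _ _ [:: tt]
  (fun _ u => (u == FMonom v)%:R) (fun _ u => (u == FMonom r)%:R)).
- by rewrite big_seq1 !pairing_basis.
- by move=> c x1 x2 z; rewrite mulrDl -scalerAl.
- by move=> c x1 x2 z; rewrite BplusN_linear mulrDr mul_scaler.
move=> [u] [q]; have E s : << FMonom s >> = word s by rewrite word.unlock.
rewrite !E BplusN_word wordM mcoeff_word cats1 eqseq_rcons eq_Node big_seq1.
by rewrite -natrM mulnb.
Qed.

(** The matrix of the dual is the transpose of the matrix of substitution. *)
Lemma mcoeff_subst_dual (a : Ns) (aT : N -> N) (x : N) v :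
  lie_series a -> subst_dual a aT -> (aT x)@_v = pairing (subst_word a v) x.
Proof.
move=> Ha HaT; rewrite -pairing_basis -HaT; apply: eq_pairing.
exact: subst_basis.
Qed.

Lemma pairing_monomial (b : Ns) w : pairing b << w >> = b w.
Proof. by rewrite pairingU mulr1. Qed.

End Series.

Unset Implicit Arguments.

Theorem theorem3p7 (k : fieldType) (char0 : [pchar k] =i pred0)
  (a : Nseries k) (ha : lie_series a)
  (aT : Npoly k -> Npoly k) (haT : subst_dual a aT) :
  aT 1 = 1 /\
  forall w : oforest, w <> mone ->
    aT << w >> =
    \sum_(p <- deconc w) \sum_(c <- LACf p.2)
       a (Rcutf c) *: (aT << p.1 >> * BplusN (aT (Pcut k c))).
Proof.
have E1 : FMonom [::] = mone :> oforest by rewrite -fmoneE.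
split=> [|w w1]; apply/malgP => -[v].
  rewrite (mcoeff_subst_dual _ _ ha haT) mcoeff_one -word0 word.unlock.
  rewrite pairing_monomial; case: v => [|t v]; first by rewrite /subst_word /= /sone E1 eqxx.
  by rewrite subst_word_eq0 //; case: t.
rewrite (mcoeff_subst_dual _ _ ha haT) pairing_monomial coef_sum.
under eq_bigr => p _ do rewrite coef_sum.
(* For the empty forest both sides vanish: [w] is nonempty, and a product ending
   in [B^+] has no constant term.  Otherwise the last tree of [v] is the [B^+]
   factor. *)
case/lastP: v => [|v [r]].
  rewrite [LHS]/subst_word /= /sone; case: eqP => // _.
  rewrite big1 // => p _; rewrite big1 // => c _.
  rewrite [LHS]mcoeffZ mcoeff_mul big_seq1 mcoeff_Bplus.
  by rewrite !mulr0.
rewrite subst_word_rcons; apply: eq_bigr => p _; apply: eq_bigr => c _.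
rewrite [RHS]mcoeffZ mcoeff_mul_Bplus !(mcoeff_subst_dual _ _ ha haT).
by rewrite pairing_monomial.
Qed.
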